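(* Let $\Omega=\{(x_1,x_2): h_0(x_1)<x_2<h_1(x_1),\ x_1\in\mathbb{R}\}$ be a nozzle as described in the context and let $Q>0$. There is at most one velocity field $\mathbf{u}=(u_1,u_2)\in C^2(\Omega)\cap C^{0,1}(\overline{\Omega})$ which (a) is a solution of the steady incompressible Euler system $(\mathbf{u}\cdot\nabla)\mathbf{u}+\nabla p=0$, $\operatorname{div}\mathbf{u}=0$ in $\Omega$ (for some pressure $p$); (b) satisfies the slip condition $\mathbf{u}\cdot\mathbf{n}=0$ on $\partial\Omega$; (c) satisfies $u_1>0$ in $\Omega$; (d) satisfies $u_1(x_1,x_2)\to 6Qx_2(1-x_2)$ as $x_1\to-\infty$, uniformly for $x_2\in[0,1]$.
   Context: Nozzle: $h_0,h_1\in C^{2,\alpha}(\mathbb{R})$ for some $\alpha\in(0,1)$, $h_1(x_1)>h_0(x_1)$ for all $x_1\in\mathbb{R}$, and there are constants $\underline{L}<0<\bar{L}$ and $0\le a<b\le 1$ such that $(h_0(x_1),h_1(x_1))=(0,1)$ for $x_1\le\underline{L}$ and $(h_0(x_1),h_1(x_1))=(a,b)$ for $x_1\ge\bar{L}$. $\mathbf{n}$ is the unit normal to $\partial\Omega$. $C^{0,1}(\overline{\Omega})$ denotes the bounded, globally Lipschitz functions on $\overline{\Omega}$. *)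

(* Defs.v *)
(* Stdlib reals with Coquelicot; the plane is the product normed module R * R,
   whose norm is the Euclidean one. *)
From Stdlib Require Import Reals Lra.
From Coquelicot Require Import Coquelicot.
Open Scope R_scope.

(* Functions on a subset of the plane are total functions on R * R; only their
   values on that subset are ever constrained or compared. *)

Definition closure (D : R * R -> Prop) (x : R * R) : Prop :=
  forall eps : posreal, exists y, ball x eps y /\ D y.

Definition boundary (D : R * R -> Prop) (x : R * R) : Prop :=
  closure D x /\ closure (fun y => ~ D y) x.

Definition ex_d1 (f : R * R -> R) (x : R * R) : Prop :=
  ex_derive (fun t => f (t, snd x)) (fst x).
Definition ex_d2 (f : R * R -> R) (x : R * R) : Prop :=
  ex_derive (fun t => f (fst x, t)) (snd x).
Definition d1 (f : R * R -> R) (x : R * R) : R :=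
  Derive (fun t => f (t, snd x)) (fst x).
Definition d2 (f : R * R -> R) (x : R * R) : R :=
  Derive (fun t => f (fst x, t)) (snd x).

(* D is meant to be open: continuity at x is not relative to D. *)
Fixpoint Ck (k : nat) (D : R * R -> Prop) (f : R * R -> R) : Prop :=
  (forall x, D x -> continuous f x) /\
  match k with
  | O => True
  | S k' =>
      (forall x, D x -> ex_d1 f x /\ ex_d2 f x) /\
      Ck k' D (d1 f) /\ Ck k' D (d2 f)
  end.

Definition comp1 (u : R * R -> R * R) (x : R * R) : R := fst (u x).
Definition comp2 (u : R * R -> R * R) (x : R * R) : R := snd (u x).

Definition C2_field (D : R * R -> Prop) (u : R * R -> R * R) : Prop :=
  Ck 2 D (comp1 u) /\ Ck 2 D (comp2 u).

Definition C01_field (D : R * R -> Prop) (u : R * R -> R * R) : Prop :=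
  exists M : R,
    (forall x, D x -> norm (u x) <= M) /\
    (forall x y, D x -> D y -> norm (minus (u x) (u y)) <= M * norm (minus x y)).

(* h has finite C^{2,alpha}(R) norm.  Continuity of the second derivative
   follows from the Hoelder bound. *)
Definition C2alpha (alpha : R) (h : R -> R) : Prop :=
  (forall x, ex_derive h x /\ ex_derive (Derive h) x) /\
  exists M : R,
    (forall x, Rabs (h x) <= M /\ Rabs (Derive h x) <= M /\
               Rabs (Derive (Derive h) x) <= M) /\
    (forall x y, x <> y ->
       Rabs (Derive (Derive h) x - Derive (Derive h) y)
         <= M * Rpower (Rabs (x - y)) alpha).

Record is_nozzle (h0 h1 : R -> R) (alpha Lm Lp a b : R) : Prop := {
  nozzle_alpha : 0 < alpha < 1;
  nozzle_h0 : C2alpha alpha h0;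
  nozzle_h1 : C2alpha alpha h1;
  nozzle_lt : forall x1, h0 x1 < h1 x1;
  nozzle_L : Lm < 0 < Lp;
  nozzle_ab : 0 <= a /\ a < b /\ b <= 1;
  nozzle_upstream : forall x1, x1 <= Lm -> h0 x1 = 0 /\ h1 x1 = 1;
  nozzle_downstream : forall x1, Lp <= x1 -> h0 x1 = a /\ h1 x1 = b
}.

Definition Omega (h0 h1 : R -> R) (x : R * R) : Prop :=
  h0 (fst x) < snd x < h1 (fst x).

Definition dot (v w : R * R) : R := fst v * fst w + snd v * snd w.

(* Outward unit normal to Omega h0 h1 at a boundary point x, which lies on the
   graph of h1 or on the graph of h0 (lemma Omega_boundary). *)
Definition unit_normal (h0 h1 : R -> R) (x : R * R) : R * R :=
  let x1 := fst x in
  if Req_EM_T (snd x) (h1 x1) then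
    (- Derive h1 x1 / sqrt (1 + Derive h1 x1 ^ 2),
     1 / sqrt (1 + Derive h1 x1 ^ 2))
  else
    (Derive h0 x1 / sqrt (1 + Derive h0 x1 ^ 2),
     - 1 / sqrt (1 + Derive h0 x1 ^ 2)).

Definition is_euler_solution (D : R * R -> Prop) (u : R * R -> R * R) : Prop :=
  let u1 := comp1 u in
  let u2 := comp2 u in
  (exists p : R * R -> R,
     Ck 1 D p /\
     forall x, D x ->
       u1 x * d1 u1 x + u2 x * d2 u1 x + d1 p x = 0 /\
       u1 x * d1 u2 x + u2 x * d2 u2 x + d2 p x = 0) /\
  (forall x, D x -> d1 u1 x + d2 u2 x = 0).

Definition slip (h0 h1 : R -> R) (u : R * R -> R * R) : Prop :=
  forall x, boundary (Omega h0 h1) x -> dot (u x) (unit_normal h0 h1 x) = 0.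

Definition poiseuille_upstream (Q : R) (u : R * R -> R * R) : Prop :=
  forall eps : posreal,
    Rbar_locally m_infty (fun x1 =>
      forall x2, 0 <= x2 <= 1 ->
        Rabs (comp1 u (x1, x2) - 6 * Q * x2 * (1 - x2)) < eps).

Record is_nozzle_flow (h0 h1 : R -> R) (Q : R) (u : R * R -> R * R) : Prop := {
  flow_C2 : C2_field (Omega h0 h1) u;
  flow_C01 : C01_field (closure (Omega h0 h1)) u;
  flow_euler : is_euler_solution (Omega h0 h1) u;
  flow_slip : slip h0 h1 u;
  flow_pos : forall x, Omega h0 h1 x -> 0 < comp1 u x;
  flow_upstream : poiseuille_upstream Q u
}.

Lemma closure_le (f g : R * R -> R) (D : R * R -> Prop) (x : R * R) :
  continuous f x -> continuous g x ->
  (forall y, D y -> f y <= g y) -> closure D x -> f x <= g x.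
Proof.
intros cf cg HD Hx.
destruct (Rle_or_lt (f x) (g x)) as [H|H]; [exact H|exfalso].
pose (e := mkposreal ((f x - g x) / 2) ltac:(lra)).
assert (HL : locally x (fun y => ball (f x) e (f y) /\ ball (g x) e (g y))).
{ apply filter_and; [apply cf | apply cg]; apply locally_ball. }
destruct HL as [d Hd].
destruct (Hx d) as [y [Hy Dy]].
destruct (Hd y Hy) as [H1 H2].
specialize (HD y Dy).
change (Rabs (f y - f x) < (f x - g x) / 2) in H1.
change (Rabs (g y - g x) < (f x - g x) / 2) in H2.
apply Rabs_def2 in H1; apply Rabs_def2 in H2; lra.
Qed.

Lemma continuous_graph (h : R -> R) (x : R * R) :
  (forall t, continuous h t) -> continuous (fun y : R * R => h (fst y)) x.
Proof.
intros H.
apply (continuous_comp fst h); [apply continuous_fst | apply H].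
Qed.

Lemma subset_closure (D : R * R -> Prop) (x : R * R) : D x -> closure D x.
Proof. intros H eps; exists x; split; [apply ball_center | exact H]. Qed.

Lemma Omega_closure (h0 h1 : R -> R) (x : R * R) :
  (forall t, continuous h0 t) -> (forall t, continuous h1 t) ->
  (forall t, h0 t < h1 t) ->
  closure (Omega h0 h1) x <-> h0 (fst x) <= snd x <= h1 (fst x).
Proof.
intros c0 c1 lt01; split.
- intros Hx; split.
  + apply (closure_le (fun y => h0 (fst y)) snd (Omega h0 h1) x);
      [now apply continuous_graph | apply continuous_snd | | exact Hx].
    intros y [H _]; lra.
  + apply (closure_le snd (fun y => h1 (fst y)) (Omega h0 h1) x);
      [apply continuous_snd | now apply continuous_graph | | exact Hx].
    intros y [_ H]; lra.
- intros Hx eps.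
  destruct x as [s t]; simpl in Hx.
  pose proof (lt01 s) as Hs; pose proof (cond_pos eps) as He.
  pose (m := (h0 s + h1 s) / 2).
  pose (k := Rmin (1 / 2) (eps / (1 + Rabs (m - t)))).
  pose proof (Rabs_pos (m - t)) as Hm.
  assert (Hk : 0 < k).
  { apply Rmin_glb_lt; [lra|]; apply Rdiv_lt_0_compat; lra. }
  assert (Hk1 : k <= 1 / 2) by apply Rmin_l.
  assert (Hk2 : k * (1 + Rabs (m - t)) <= eps).
  { apply Rle_trans with (eps / (1 + Rabs (m - t)) * (1 + Rabs (m - t))).
    - apply Rmult_le_compat_r; [lra | apply Rmin_r].
    - right; field; lra. }
  exists (s, t + k * (m - t)); split.
  + split; simpl.
    * apply ball_center.
    * change (Rabs (t + k * (m - t) - t) < eps).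
      replace (t + k * (m - t) - t) with (k * (m - t)) by ring.
      rewrite Rabs_mult, (Rabs_pos_eq k) by lra.
      nra.
  + unfold Omega; simpl; unfold m; split; nra.
Qed.

Lemma Omega_boundary (h0 h1 : R -> R) (x : R * R) :
  (forall t, continuous h0 t) -> (forall t, continuous h1 t) ->
  (forall t, h0 t < h1 t) ->
  boundary (Omega h0 h1) x <-> snd x = h0 (fst x) \/ snd x = h1 (fst x).
Proof.
intros c0 c1 lt01; unfold boundary.
rewrite (Omega_closure h0 h1 x c0 c1 lt01).
pose proof (lt01 (fst x)) as Hx; split.
- intros [[H0 H1] HC].
  destruct (Req_dec (snd x) (h0 (fst x))) as [e|n0]; [now left|].
  destruct (Req_dec (snd x) (h1 (fst x))) as [e|n1]; [now right|].
  exfalso.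
  assert (Hle : Rmin (snd x - h0 (fst x)) (h1 (fst x) - snd x) <= 0).
  { apply (closure_le
      (fun y => Rmin (snd y - h0 (fst y)) (h1 (fst y) - snd y))
      (fun _ => 0) (fun y => ~ Omega h0 h1 y) x); [ | apply continuous_const | | exact HC].
    - apply continuous_ext with (fun y : R * R =>
        ((h1 (fst y) - h0 (fst y)) - Rabs ((snd y - h0 (fst y)) - (h1 (fst y) - snd y))) * / 2).
      { intros y; unfold Rmin; destruct Rle_dec;
        [rewrite Rabs_left1 by lra | rewrite Rabs_right by lra]; lra. }
      assert (g0 := continuous_graph h0 x c0).
      assert (g1 := continuous_graph h1 x c1).
      assert (g2 : continuous (fun y : R * R => snd y) x) by apply continuous_snd.
      apply (continuous_mult (K := R_AbsRing)); [|apply continuous_const].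
      apply (continuous_minus (V := R_NormedModule)).
      + now apply (continuous_minus (V := R_NormedModule)).
      + apply (continuous_comp _ Rabs); [|apply continuous_Rabs].
        apply (continuous_minus (V := R_NormedModule));
        now apply (continuous_minus (V := R_NormedModule)).
    - intros y Hy; unfold Omega in Hy.
      destruct (Rle_or_lt (Rmin (snd y - h0 (fst y)) (h1 (fst y) - snd y)) 0)
        as [H|H]; [exact H|].
      exfalso; apply Hy.
      pose proof (Rmin_l (snd y - h0 (fst y)) (h1 (fst y) - snd y)).
      pose proof (Rmin_r (snd y - h0 (fst y)) (h1 (fst y) - snd y)).
      lra. }
  unfold Rmin in Hle; destruct Rle_dec in Hle; lra.
- intros H; split; [lra|].
  apply subset_closure; unfold Omega; lra.
Qed.

(* Main.v *)
Require Import Defs.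
From Stdlib Require Import Reals Lra ClassicalEpsilon.
From Coquelicot Require Import Coquelicot.
Open Scope R_scope.

(* In the coordinates (x, s), where s is the stream function, let Y(x, s) be the
   height of the streamline s.  Then Y_x = u2 / u1, Y_s = 1 / u1, and the momentum
   equation reads d_x u2 + d_s p = 0 with p + |u|^2 / 2 = B(s); the upstream
   condition makes B, up to a constant, common to all solutions.  This system is
   the Euler-Lagrange equation of a functional that is convex in the gradient of Y
   and does not involve Y itself.  For two solutions u, v with heights Y, Z put
   W = Y - Z; then
     d_x (W (u2 - v2)) + d_s (W (p_u - p_v)) = (1/u1 + 1/v1) |u - v|^2 / 2,
   where W = 0 on the walls.  Hence E(x) = int W (u2 - v2) ds is bounded on the
   whole line and satisfies E' >= c E^2, so E = 0, the right-hand side vanishes,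
   and u = v along each streamline, whence Y = Z.  Since 1/u1 may blow up at the
   walls, the identity is integrated over d < s < Q - d and d tends to 0. *)

(** * Real analysis *)

(** The comparison rests on facts that the hypotheses do not state: every section carries the same
    flux [Q], and [u2] tends to zero upstream although only [u1] is prescribed there. Both have to
    be extracted from the equations together with the Lipschitz bounds. One obstacle is regularity
    at the walls. The velocity has derivatives only inside, while the slip condition holds only on
    the boundary. Flux computations are therefore made between curves at a small fraction [th] of
    the channel height, where the Lipschitz bounds make the flux across the curve at most linear in
    [th]; then [th] tends to zero. The other obstacle is that streamlines of small flux are close to
    the walls uniformly only for bounded [x]. Hence the differential inequality for the energy is
    not integrated over the whole line: the length on which an energy of given size would outgrow
    its bound is fixed first, and [d] is then taken small for that interval alone. *)

Lemma increment_ge (f df : R -> R) (a b m : R) :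
  a <= b -> (forall x, a <= x <= b -> is_derive f x (df x)) ->
  (forall x, a <= x <= b -> m <= df x) -> m * (b - a) <= f b - f a.
Proof.
intros Hab Hd Hm.
destruct (MVT_gen f a b df) as [c [Hc E]].
- intros x Hx; apply Hd; rewrite Rmin_left, Rmax_right in Hx; lra.
- intros x Hx; rewrite Rmin_left, Rmax_right in Hx by lra.
  apply continuity_pt_filterlim, (ex_derive_continuous (V := R_NormedModule)).
  exists (df x); apply Hd; lra.
- rewrite Rmin_left, Rmax_right in Hc by lra.
  rewrite E; apply Rmult_le_compat_r; [lra|]; apply Hm; lra.
Qed.

Lemma increment_abs_le (f df : R -> R) (a b M : R) :
  (forall x, Rmin a b <= x <= Rmax a b -> is_derive f x (df x)) ->
  (forall x, Rmin a b <= x <= Rmax a b -> Rabs (df x) <= M) ->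
  Rabs (f b - f a) <= M * Rabs (b - a).
Proof.
intros Hd Hm.
destruct (MVT_gen f a b df) as [c [Hc E]].
- intros x Hx; apply Hd; lra.
- intros x Hx.
  apply continuity_pt_filterlim, (ex_derive_continuous (V := R_NormedModule)).
  exists (df x); apply Hd; lra.
- rewrite E, Rabs_mult; apply Rmult_le_compat_r; [apply Rabs_pos|now apply Hm].
Qed.

Lemma continuity_2d_pt_continuous_1 (f : R -> R -> R) (x y : R) :
  continuity_2d_pt f x y -> continuous (fun t => f t y) x.
Proof.
intros H; apply filterlim_locally; intros eps.
destruct (H eps) as [d Hd]; exists d; intros t Ht.
apply Hd; [exact Ht|]; rewrite Rminus_diag, Rabs_R0; apply cond_pos.
Qed.

Lemma continuity_2d_pt_continuous_2 (f : R -> R -> R) (x y : R) :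
  continuity_2d_pt f x y -> continuous (fun t => f x t) y.
Proof.
intros H; apply filterlim_locally; intros eps.
destruct (H eps) as [d Hd]; exists d; intros t Ht.
apply Hd; [|exact Ht]; rewrite Rminus_diag, Rabs_R0; apply cond_pos.
Qed.

Lemma ex_RInt_strip (f : R -> R -> R) (lo hi a b x : R) :
  lo < a -> a <= b -> b < hi ->
  (forall s, lo < s < hi -> continuity_2d_pt f x s) ->
  ex_RInt (fun s => f x s) a b.
Proof.
intros Ha Hab Hb Hc.
apply (ex_RInt_continuous (V := R_CompleteNormedModule)); intros s Hs.
rewrite Rmin_left, Rmax_right in Hs by lra.
apply continuity_2d_pt_continuous_2, Hc; lra.
Qed.

Lemma is_derive_RInt_strip (f df : R -> R -> R) (lo hi a b x : R) :
  lo < a -> a <= b -> b < hi ->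
  (forall x s, lo < s < hi -> is_derive (fun t => f t s) x (df x s)) ->
  (forall x s, lo < s < hi -> continuity_2d_pt f x s) ->
  (forall x s, lo < s < hi -> continuity_2d_pt df x s) ->
  is_derive (fun t => RInt (fun s => f t s) a b) x (RInt (fun s => df x s) a b).
Proof.
intros Ha Hab Hb Hd Hf Hdf.
replace (RInt (fun s => df x s) a b)
  with (RInt (fun s => Derive (fun t => f t s) x) a b).
2:{ apply RInt_ext; intros s Hs; rewrite Rmin_left, Rmax_right in Hs by lra.
    apply is_derive_unique, Hd; lra. }
apply is_derive_RInt_param.
- apply filter_forall; intros t s Hs; rewrite Rmin_left, Rmax_right in Hs by lra.
  exists (df t s); apply Hd; lra.
- intros s Hs; rewrite Rmin_left, Rmax_right in Hs by lra.
  apply continuity_2d_pt_ext_loc with df; [|apply Hdf; lra].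
  assert (He : 0 < Rmin (s - lo) (hi - s)) by (apply Rmin_glb_lt; lra).
  exists (mkposreal _ He); simpl; intros t r _ Hr.
  symmetry; apply is_derive_unique, Hd.
  pose proof (Rmin_l (s - lo) (hi - s)); pose proof (Rmin_r (s - lo) (hi - s)).
  apply Rabs_def2 in Hr; lra.
- apply filter_forall; intros t; apply ex_RInt_strip with lo hi; auto.
Qed.

Lemma derive_lim_zero_of_bounded (f df : R -> R) (C l : R) :
  (forall x, is_derive f x (df x)) -> (forall x, Rabs (f x) <= C) ->
  is_lim df m_infty l -> l = 0.
Proof.
intros Hd Hb Hl.
assert (key : forall g dg, (forall x, is_derive g x (dg x)) ->
  (forall x, Rabs (g x) <= C) -> forall k, is_lim dg m_infty (Finite k) -> k <= 0).
{ clear; intros g dg Hd Hb k Hl.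
  destruct (Rle_or_lt k 0) as [H|H]; [exact H|exfalso].
  apply is_lim_spec in Hl.
  destruct (Hl (mkposreal (k / 2) ltac:(lra))) as [N HN]; simpl in HN.
  pose proof (Rle_trans _ _ _ (Rabs_pos _) (Hb 0)) as HC.
  (* On an interval of length [T] a slope of at least [k / 2] gives an increment of [2 * (C + 1)],
     while the bound on [g] allows at most [2 * C]. *)
  set (T := 4 * (C + 1) / k).
  assert (HT : k * T = 4 * (C + 1)) by (unfold T; field; lra).
  assert (0 < T) by (unfold T; apply Rdiv_lt_0_compat; lra).
  assert (I := increment_ge g dg (N - 1 - T) (N - 1) (k / 2)
    ltac:(lra) (fun x _ => Hd x)).
  assert (k / 2 * (N - 1 - (N - 1 - T)) <= g (N - 1) - g (N - 1 - T)).
  { apply I; intros x Hx; assert (A := HN x ltac:(lra)); apply Rabs_def2 in A; lra. }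
  pose proof (Hb (N - 1)) as A1; pose proof (Hb (N - 1 - T)) as A2.
  apply Rabs_le_between in A1; apply Rabs_le_between in A2; nra. }
apply Rle_antisym.
- now apply (key f df).
- enough (- l <= 0) by lra.
  apply (key (fun x => - f x) (fun x => - df x)).
  + intros x; apply (is_derive_opp (V := R_NormedModule) f), Hd.
  + intros x; rewrite Rabs_Ropp; apply Hb.
  + now apply (is_lim_opp df m_infty l).
Qed.

Lemma is_derive_of_little_o (f : R -> R) (x l : R) :
  (forall eps, 0 < eps -> exists d, 0 < d /\ forall t, Rabs (t - x) < d ->
     Rabs (f t - f x - l * (t - x)) <= eps * Rabs (t - x)) ->
  is_derive f x l.
Proof.
intros Hf; apply is_derive_Reals; intros eps He.
destruct (Hf (eps / 2)) as [d [Hd Hfd]]; [lra|].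
exists (mkposreal d Hd); simpl; intros h Hh Hhd.
assert (A := Hfd (x + h)); replace (x + h - x) with h in A by ring.
apply Rabs_pos_lt in Hh.
replace ((f (x + h) - f x) / h - l) with ((f (x + h) - f x - l * h) / h).
- unfold Rdiv; rewrite Rabs_mult, Rabs_inv.
  apply Rmult_lt_reg_r with (Rabs h); [assumption|].
  rewrite Rmult_assoc, Rinv_l by lra; specialize (A Hhd); nra.
- field; intros E; rewrite E, Rabs_R0 in Hh; lra.
Qed.

Lemma differentiable_pt_lim_comp_curve (f : R -> R -> R) (g : R -> R)
    (x lx ly dg : R) :
  differentiable_pt_lim f x (g x) lx ly -> is_derive g x dg ->
  is_derive (fun t => f t (g t)) x (lx + ly * dg).
Proof.
intros Hf Hg; apply is_derive_Reals.
replace (lx + ly * dg) with (lx * 1 + ly * dg) by ring.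
apply derivable_pt_lim_comp_2d with (f2 := fun t => t);
  [assumption | apply derivable_pt_lim_id | now apply is_derive_Reals].
Qed.

Lemma differentiable_pt_lim_1 (f : R -> R -> R) (x y lx ly : R) :
  differentiable_pt_lim f x y lx ly -> is_derive (fun t => f t y) x lx.
Proof.
intros Hf; replace lx with (lx + ly * 0) by ring.
apply (differentiable_pt_lim_comp_curve f (fun _ => y)); [assumption|].
apply (is_derive_const (V := R_NormedModule)).
Qed.

Lemma differentiable_pt_lim_2 (f : R -> R -> R) (x y lx ly : R) :
  differentiable_pt_lim f x y lx ly -> is_derive (fun t => f x t) y ly.
Proof.
intros Hf; apply is_derive_Reals.
replace ly with (lx * 0 + ly * 1) by ring.
apply derivable_pt_lim_comp_2d with (f2 := fun _ => x) (f3 := fun t => t);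
  [assumption | apply derivable_pt_lim_const | apply derivable_pt_lim_id].
Qed.

Lemma differentiable_pt_lim_of_partials (f fx : R -> R -> R) (x y fy : R) :
  locally_2d (fun x y => is_derive (fun t => f t y) x (fx x y)) x y ->
  is_derive (fun t => f x t) y fy -> continuity_2d_pt fx x y ->
  differentiable_pt_lim f x y (fx x y) fy.
Proof.
intros H1 H2 H3; apply filterdiff_differentiable_pt_lim.
apply (is_derive_filterdiff f x y fx fy); [|assumption|].
- exact (proj1 (locally_2d_locally (fun x y => is_derive (fun t => f t y) x (fx x y)) x y) H1).
- now apply continuity_2d_pt_filterlim in H3.
Qed.

Lemma is_derive_continuous (f : R -> R) (x l : R) :
  is_derive f x l -> continuous f x.
Proof.
intros Hf; apply (ex_derive_continuous (V := R_NormedModule)); now exists l.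
Qed.

Lemma continuous_eps (f : R -> R) (x eps : R) : continuous f x -> 0 < eps ->
  exists d, 0 < d /\ forall t, Rabs (t - x) < d -> Rabs (f t - f x) < eps.
Proof.
intros Hf He.
destruct (proj1 (filterlim_locally _ _) Hf (mkposreal eps He)) as [d Hd].
exists d; split; [apply cond_pos|]; intros t Ht; apply (Hd t Ht).
Qed.

Lemma continuous_of_lipschitz (f : R -> R) (C x : R) :
  (forall y z, Rabs (f y - f z) <= C * Rabs (y - z)) -> continuous f x.
Proof.
intros Hf; apply filterlim_locally; intros eps.
assert (HC : 0 <= C).
{ pose proof (Hf 1 0) as A; rewrite Rminus_0_r, Rabs_R1 in A.
  pose proof (Rabs_pos (f 1 - f 0)); lra. }
assert (Hd : 0 < eps / (C + 1)) by (apply Rdiv_lt_0_compat; [apply cond_pos|lra]).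
exists (mkposreal _ Hd); intros y Hy.
change (Rabs (y - x) < eps / (C + 1)) in Hy; change (Rabs (f y - f x) < eps).
eapply Rle_lt_trans; [apply Hf|].
apply Rle_lt_trans with ((C + 1) * Rabs (y - x)).
- pose proof (Rabs_pos (y - x)); nra.
- apply Rlt_le_trans with ((C + 1) * (eps / (C + 1)));
  [apply Rmult_lt_compat_l; lra | right; field; lra].
Qed.

(** Passage to the limit [th -> 0] in estimates with an error linear in [th]. The range below
    [1 / 2] keeps the curves at fractions [th] and [1 - th] of the height in order. *)
Lemma le_of_le_add_small (a c k : R) :
  (forall th, 0 < th < 1 / 2 -> a <= c + k * th) -> 0 <= k -> a <= c.
Proof.
intros Ha Hk; apply Rnot_lt_le; intros Hlt.
assert (H1 : 0 < (a - c) / (k + 1) / 2).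
{ apply Rdiv_lt_0_compat; [apply Rdiv_lt_0_compat|]; lra. }
assert (A := Ha (Rmin (1 / 4) ((a - c) / (k + 1) / 2))).
assert (H2 : 0 < Rmin (1 / 4) ((a - c) / (k + 1) / 2)) by (apply Rmin_glb_lt; lra).
pose proof (Rmin_l (1 / 4) ((a - c) / (k + 1) / 2)).
pose proof (Rmin_r (1 / 4) ((a - c) / (k + 1) / 2)).
specialize (A ltac:(lra)); set (th := Rmin _ _) in *.
assert ((k + 1) * th <= (a - c) / 2).
{ apply Rle_trans with ((k + 1) * ((a - c) / (k + 1) / 2));
  [apply Rmult_le_compat_l; lra | right; field; lra]. }
nra.
Qed.

(** Serves for both derivatives of the streamline height: [k = 0] along a streamline, [k = 1] when
    the flux itself is the variable. Because [g] is already known to be continuous,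
    differentiability of [F] at one point is enough. *)
Lemma is_derive_implicit (F : R -> R -> R) (g : R -> R) (t0 Fx Fy k : R) :
  differentiable_pt_lim F t0 (g t0) Fx Fy -> Fy <> 0 -> continuous g t0 ->
  locally t0 (fun t => F t (g t) = F t0 (g t0) + k * (t - t0)) ->
  is_derive g t0 ((k - Fx) / Fy).
Proof.
intros HF HFy Hg Hloc; apply is_derive_of_little_o; intros eps He.
apply Rabs_pos_lt in HFy as Hp.
set (l := (k - Fx) / Fy); pose proof (Rabs_pos l).
(* The first bound lets the term [e * Rabs (r - l * h)] be absorbed on the left; the second turns
   the remaining [e * (1 + Rabs l) * Rabs h] into the required [eps * Rabs h]. *)
set (e := Rmin (Rabs Fy / 2) (eps * Rabs Fy / (2 * (1 + Rabs l)))).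
assert (e_pos : 0 < e).
{ apply Rmin_glb_lt; [lra|]; apply Rdiv_lt_0_compat; [|lra].
  now apply Rmult_lt_0_compat. }
assert (e1 : e <= Rabs Fy / 2) by apply Rmin_l.
assert (e2 : e * (1 + Rabs l) <= eps * Rabs Fy / 2).
{ apply Rle_trans with (eps * Rabs Fy / (2 * (1 + Rabs l)) * (1 + Rabs l));
  [apply Rmult_le_compat_r; [lra | apply Rmin_r] | right; field; lra]. }
destruct (HF (mkposreal e e_pos)) as [d1 D1]; simpl in D1.
destruct (continuous_eps g t0 d1 Hg (cond_pos d1)) as [d2 [Hd2 D2]].
destruct Hloc as [d3 D3].
pose proof (cond_pos d1); pose proof (cond_pos d3).
exists (Rmin d1 (Rmin d2 d3)); split; [repeat apply Rmin_glb_lt; lra|].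
intros t Ht.
pose proof (Rmin_l d1 (Rmin d2 d3)); pose proof (Rmin_r d1 (Rmin d2 d3)).
pose proof (Rmin_l d2 d3); pose proof (Rmin_r d2 d3).
assert (A := D1 t (g t) ltac:(lra) (D2 t ltac:(lra))).
rewrite (D3 t) in A by (change (Rabs (t - t0) < d3); lra).
set (h := t - t0) in *; set (r := g t - g t0) in *.
replace (F t0 (g t0) + k * h - F t0 (g t0) - (Fx * h + Fy * r))
  with (- (Fy * (r - l * h))) in A by (unfold l; field; assumption).
rewrite Rabs_Ropp, Rabs_mult in A.
assert (B : Rabs r <= Rabs (r - l * h) + Rabs l * Rabs h).
{ rewrite <- Rabs_mult; replace r with ((r - l * h) + l * h) at 1 by ring.
  apply Rabs_triang. }
assert (B' : Rmax (Rabs h) (Rabs r) <= Rabs h + Rabs r).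
{ pose proof (Rabs_pos h); pose proof (Rabs_pos r); apply Rmax_lub; lra. }
pose proof (Rabs_pos h); pose proof (Rabs_pos (r - l * h)).
set (x := Rabs (r - l * h)) in *.
assert (A2 : Rabs Fy * x <= e * (Rabs h + (x + Rabs l * Rabs h))).
{ eapply Rle_trans; [exact A|]; apply Rmult_le_compat_l; lra. }
assert (A3 : e * x <= Rabs Fy / 2 * x) by (apply Rmult_le_compat_r; lra).
assert (A4 : e * (1 + Rabs l) * Rabs h <= eps * Rabs Fy / 2 * Rabs h)
  by (apply Rmult_le_compat_r; lra).
apply Rmult_le_reg_l with (Rabs Fy / 2); [lra|]; nra.
Qed.

Lemma graph_domain_open (h0 h1 : R -> R) (x y : R) :
  continuous h0 x -> continuous h1 x -> h0 x < y < h1 x ->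
  locally_2d (fun x y => h0 x < y < h1 x) x y.
Proof.
intros c0 c1 Hy.
assert (He : 0 < Rmin (y - h0 x) (h1 x - y) / 2).
{ apply Rdiv_lt_0_compat; [apply Rmin_glb_lt|]; lra. }
pose proof (Rmin_l (y - h0 x) (h1 x - y)); pose proof (Rmin_r (y - h0 x) (h1 x - y)).
destruct (continuous_eps h0 x _ c0 He)
  as [d0 [Hd0 A0]].
destruct (continuous_eps h1 x _ c1 He)
  as [d1 [Hd1 A1]].
set (e := Rmin (y - h0 x) (h1 x - y) / 2) in *.
assert (e <= (y - h0 x) / 2 /\ e <= (h1 x - y) / 2) by (unfold e; lra).
assert (Hd : 0 < Rmin e (Rmin d0 d1)) by (repeat apply Rmin_glb_lt; assumption).
exists (mkposreal _ Hd); simpl; intros t z Ht Hz.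
pose proof (Rmin_l e (Rmin d0 d1)); pose proof (Rmin_r e (Rmin d0 d1)).
pose proof (Rmin_l d0 d1); pose proof (Rmin_r d0 d1).
assert (B0 := A0 t ltac:(lra)); assert (B1 := A1 t ltac:(lra)).
apply Rabs_def2 in B0; apply Rabs_def2 in B1; apply Rabs_def2 in Hz; lra.
Qed.

(** * Comparison of two flows in streamline coordinates *)

(* [Y], [(U1, U2)] and [P] are the height, velocity and pressure along the streamline carrying flux [s]; [G] is the derivative of [P] in [s] and [c] the squared upstream speed. *)
Record hodograph (h0 h1 : R -> R) (Q K : R) (c : R -> R)
    (Y U1 U2 P G : R -> R -> R) (B : R -> R) : Prop := {
  hod_Y : forall x s, 0 < s < Q -> h0 x <= Y x s <= h1 x;
  hod_U1 : forall x s, 0 < s < Q -> 0 < U1 x s <= K;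
  hod_U2 : forall x s, 0 < s < Q -> Rabs (U2 x s) <= K;
  hod_Y_x : forall x s, 0 < s < Q ->
    is_derive (fun t => Y t s) x (U2 x s / U1 x s);
  hod_Y_s : forall x s, 0 < s < Q -> is_derive (fun t => Y x t) s (/ U1 x s);
  hod_U2_x : forall x s, 0 < s < Q -> is_derive (fun t => U2 t s) x (- G x s);
  hod_P_s : forall x s, 0 < s < Q -> is_derive (fun t => P x t) s (G x s);
  hod_Bernoulli : forall x s, 0 < s < Q ->
    P x s + (U1 x s ^ 2 + U2 x s ^ 2) / 2 = B s;
  hod_Y_cont : forall x s, 0 < s < Q -> continuity_2d_pt Y x s;
  hod_U1_cont : forall x s, 0 < s < Q -> continuity_2d_pt U1 x s;
  hod_U2_cont : forall x s, 0 < s < Q -> continuity_2d_pt U2 x s;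
  hod_G_cont : forall x s, 0 < s < Q -> continuity_2d_pt G x s;
  hod_walls : forall T eps, 0 < eps -> exists d0, 0 < d0 /\
    forall d x, 0 < d < d0 -> d < Q -> Rabs x <= T ->
      Y x d - h0 x <= eps /\ h1 x - Y x (Q - d) <= eps;
  hod_upstream : forall s, 0 < s < Q ->
    is_lim (fun x => U1 x s ^ 2 + U2 x s ^ 2) m_infty (c s)
}.

Arguments hod_Y {h0 h1 Q K c Y U1 U2 P G B} _.
Arguments hod_U1 {h0 h1 Q K c Y U1 U2 P G B} _.
Arguments hod_U2 {h0 h1 Q K c Y U1 U2 P G B} _.
Arguments hod_Y_x {h0 h1 Q K c Y U1 U2 P G B} _.
Arguments hod_Y_s {h0 h1 Q K c Y U1 U2 P G B} _.
Arguments hod_U2_x {h0 h1 Q K c Y U1 U2 P G B} _.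
Arguments hod_P_s {h0 h1 Q K c Y U1 U2 P G B} _.
Arguments hod_Bernoulli {h0 h1 Q K c Y U1 U2 P G B} _.
Arguments hod_Y_cont {h0 h1 Q K c Y U1 U2 P G B} _.
Arguments hod_U1_cont {h0 h1 Q K c Y U1 U2 P G B} _.
Arguments hod_U2_cont {h0 h1 Q K c Y U1 U2 P G B} _.
Arguments hod_G_cont {h0 h1 Q K c Y U1 U2 P G B} _.
Arguments hod_walls {h0 h1 Q K c Y U1 U2 P G B} _.
Arguments hod_upstream {h0 h1 Q K c Y U1 U2 P G B} _.

Section Comparison.

Variables (h0 h1 : R -> R) (Q K H : R) (c : R -> R).
Variables (Y U1 U2 P G : R -> R -> R) (B : R -> R).
Variables (Z V1 V2 R' L : R -> R -> R) (B' : R -> R).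
Hypothesis (height : forall x, h1 x - h0 x <= H).
Hypothesis (HU : hodograph h0 h1 Q K c Y U1 U2 P G B).
Hypothesis (HV : hodograph h0 h1 Q K c Z V1 V2 R' L B').

(** The integral [phi] of [U2 - V2] between the two streamlines is bounded, and by the momentum
    equation its slope is minus the change of [P - R'] from [s1] to [s2]. Upstream both squared
    speeds tend to the same [c s], so the slope converges to minus the change of [B - B']; a bounded
    function admits only the limit zero. *)
Lemma Bernoulli_difference_const (s1 s2 : R) :
  0 < s1 -> s1 <= s2 -> s2 < Q -> B s2 - B' s2 = B s1 - B' s1.
Proof.
intros H1 H12 H2.
pose (phi := fun x => RInt (fun s => U2 x s - V2 x s) s1 s2).
pose (D := fun x s => P x s - R' x s).
assert (Hphi : forall x, is_derive phi x (- (D x s2 - D x s1))).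
{ intros x.
  replace (- (D x s2 - D x s1)) with (RInt (fun s => - (G x s) - - (L x s)) s1 s2).
  { apply (is_derive_RInt_strip (fun x s => U2 x s - V2 x s)
      (fun x s => - (G x s) - - (L x s)) 0 Q); try assumption.
    - intros y s Hs; apply (is_derive_minus (V := R_NormedModule));
        [now apply (hod_U2_x HU)
        |now apply (hod_U2_x HV)].
    - intros y s Hs; apply continuity_2d_pt_minus;
        [now apply (hod_U2_cont HU)
        |now apply (hod_U2_cont HV)].
    - intros y s Hs; apply continuity_2d_pt_minus; apply continuity_2d_pt_opp;
        [now apply (hod_G_cont HU)
        |now apply (hod_G_cont HV)]. }
  apply is_RInt_unique.
  replace (- (D x s2 - D x s1)) with (minus (- D x s2) (- D x s1))
    by (unfold minus, plus, opp; simpl; ring).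
  apply (is_RInt_derive (V := R_CompleteNormedModule) (fun s => - D x s)).
  - intros s Hs; rewrite Rmin_left, Rmax_right in Hs by lra.
    replace (- G x s - - L x s) with (- (G x s - L x s)) by ring.
    apply (is_derive_opp (V := R_NormedModule) (D x)).
    apply (is_derive_minus (V := R_NormedModule));
      [apply (hod_P_s HU)
      |apply (hod_P_s HV)]; lra.
  - intros s Hs; rewrite Rmin_left, Rmax_right in Hs by lra.
    apply (continuity_2d_pt_continuous_2 (fun x s => - G x s - - L x s)).
    apply continuity_2d_pt_minus; apply continuity_2d_pt_opp;
      [apply (hod_G_cont HU)
      |apply (hod_G_cont HV)]; lra. }
assert (Hbd : forall x, Rabs (phi x) <= (s2 - s1) * (K + K)).
{ intros x; apply abs_RInt_le_const; [assumption| |].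
  - apply (ex_RInt_strip (fun x s => U2 x s - V2 x s) 0 Q); try assumption.
    intros s Hs; apply continuity_2d_pt_minus;
      [now apply (hod_U2_cont HU)
      |now apply (hod_U2_cont HV)].
  - intros s Hs.
    assert (E1 := hod_U2 HU x s ltac:(lra)).
    assert (E2 := hod_U2 HV x s ltac:(lra)).
    apply Rabs_le_between in E1; apply Rabs_le_between in E2.
    apply Rabs_le; lra. }
enough (- (B s2 - B' s2 - (B s1 - B' s1)) = 0) by lra.
apply (derive_lim_zero_of_bounded phi _ _ _ Hphi Hbd).
assert (Hlim : forall s, 0 < s < Q ->
  is_lim (fun x => D x s) m_infty (B s - B' s)).
{ intros s Hs.
  apply is_lim_ext with (fun x => (B s - B' s)
    + / 2 * ((V1 x s ^ 2 + V2 x s ^ 2) - (U1 x s ^ 2 + U2 x s ^ 2))).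
  { intros x; unfold D.
    rewrite <- (hod_Bernoulli HU x s Hs).
    rewrite <- (hod_Bernoulli HV x s Hs); field. }
  replace (Finite (B s - B' s)) with (Finite ((B s - B' s) + / 2 * (c s - c s)))
    by (f_equal; ring).
  apply (is_lim_plus' _ _ _ (B s - B' s) (/ 2 * (c s - c s)));
    [apply is_lim_const|].
  apply (is_lim_scal_l _ (/ 2) m_infty (c s - c s)).
  apply (is_lim_minus' _ _ _ (c s) (c s));
    [now apply (hod_upstream HV)
    |now apply (hod_upstream HU)]. }
apply (is_lim_opp _ m_infty (B s2 - B' s2 - (B s1 - B' s1))).
apply (is_lim_minus' _ _ _ (B s2 - B' s2) (B s1 - B' s1)); apply Hlim; lra.
Qed.

(** * The energy identity between two flows *)

Let k := B (Q / 2) - B' (Q / 2).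
Let W x s := Y x s - Z x s.
(** The pressure difference normalised by [k], as [pressure_difference] shows. In terms of the
    speeds it is visibly bounded up to the walls, while the pressures come with no bound. *)
Let D x s := (V1 x s ^ 2 + V2 x s ^ 2 - (U1 x s ^ 2 + U2 x s ^ 2)) / 2.
Let dissipation x s :=
  (/ U1 x s + / V1 x s) / 2 * ((U1 x s - V1 x s) ^ 2 + (U2 x s - V2 x s) ^ 2).
Let energy d x := RInt (fun s => W x s * (U2 x s - V2 x s)) d (Q - d).

Lemma pressure_difference (x s : R) :
  0 < s < Q -> P x s - R' x s - k = D x s.
Proof.
intros Hs; unfold D, k.
assert (E : B s - B' s = B (Q / 2) - B' (Q / 2)).
{ destruct (Rle_or_lt s (Q / 2));
  [symmetry|]; apply Bernoulli_difference_const; lra. }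
pose proof (hod_Bernoulli HU x s Hs); pose proof (hod_Bernoulli HV x s Hs); lra.
Qed.

Lemma dissipation_cont (x s : R) :
  0 < s < Q -> continuity_2d_pt dissipation x s.
Proof.
intros Hs.
pose proof (hod_U1_cont HU x s Hs); pose proof (hod_U1_cont HV x s Hs).
pose proof (hod_U2_cont HU x s Hs); pose proof (hod_U2_cont HV x s Hs).
pose proof (hod_U1 HU x s Hs); pose proof (hod_U1 HV x s Hs).
assert (sq : forall f, continuity_2d_pt f x s ->
  continuity_2d_pt (fun u v => f u v ^ 2) x s).
{ intros f Hf; apply continuity_2d_pt_ext with (fun u v => f u v * f u v);
  [intros; ring | now apply continuity_2d_pt_mult]. }
apply continuity_2d_pt_mult.
- apply continuity_2d_pt_mult; [|apply continuity_2d_pt_const].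
  apply continuity_2d_pt_plus; apply continuity_2d_pt_inv; trivial; lra.
- apply continuity_2d_pt_plus; apply (sq (fun u v => _ - _));
  now apply continuity_2d_pt_minus.
Qed.

(** The mean of [/ U1] and [/ V1] is at least [/ K]. This lower bound is uniform up to the walls,
    where the inverse speeds themselves may blow up. *)
Lemma dissipation_ge (x s : R) : 0 < s < Q ->
  ((U1 x s - V1 x s) ^ 2 + (U2 x s - V2 x s) ^ 2) / K <= dissipation x s.
Proof.
intros Hs; unfold dissipation.
destruct (hod_U1 HU x s Hs) as [p1 q1]; destruct (hod_U1 HV x s Hs) as [p2 q2].
pose proof (Rinv_le_contravar _ _ p1 q1); pose proof (Rinv_le_contravar _ _ p2 q2).
pose proof (pow2_ge_0 (U1 x s - V1 x s)); pose proof (pow2_ge_0 (U2 x s - V2 x s)).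
unfold Rdiv at 1; rewrite Rmult_comm; apply Rmult_le_compat_r; lra.
Qed.

Lemma is_derive_energy (d x : R) : 0 < d -> d <= Q - d ->
  is_derive (energy d) x
    (RInt (fun s => dissipation x s) d (Q - d)
     - (W x (Q - d) * D x (Q - d) - W x d * D x d)).
Proof.
intros Hd HdQ.
pose (de := fun x s => (U2 x s / U1 x s - V2 x s / V1 x s) * (U2 x s - V2 x s)
  + W x s * (- G x s - - L x s)).
pose (df := fun x s => (/ U1 x s - / V1 x s) * D x s + W x s * (G x s - L x s)).
assert (cW : forall x s, 0 < s < Q -> continuity_2d_pt W x s).
{ intros y s Hs; apply continuity_2d_pt_minus;
  [now apply (hod_Y_cont HU) | now apply (hod_Y_cont HV)]. }
assert (c2 : forall x s, 0 < s < Q ->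
  continuity_2d_pt (fun x s => U2 x s - V2 x s) x s).
{ intros y s Hs; apply continuity_2d_pt_minus;
  [now apply (hod_U2_cont HU) | now apply (hod_U2_cont HV)]. }
assert (cde : forall x s, 0 < s < Q -> continuity_2d_pt de x s).
{ intros y s Hs.
  pose proof (hod_U1 HU y s Hs); pose proof (hod_U1 HV y s Hs).
  apply continuity_2d_pt_plus; apply continuity_2d_pt_mult; auto;
    apply continuity_2d_pt_minus.
  - apply continuity_2d_pt_mult; [now apply (hod_U2_cont HU)|].
    apply continuity_2d_pt_inv; [now apply (hod_U1_cont HU) | lra].
  - apply continuity_2d_pt_mult; [now apply (hod_U2_cont HV)|].
    apply continuity_2d_pt_inv; [now apply (hod_U1_cont HV) | lra].
  - now apply continuity_2d_pt_opp, (hod_G_cont HU).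
  - now apply continuity_2d_pt_opp, (hod_G_cont HV). }
(* The terms in [G] and [L] cancel between [de] and [df]. The rest is algebra: the terms in [U2],
   [V2] form one half of [(U2 - V2) ^ 2] for each inverse speed, and those in [U1], [V1] combine
   through [/ U1 - / V1 = (V1 - U1) / (U1 * V1)]. *)
assert (E : forall s, 0 < s < Q -> df x s = dissipation x s - de x s).
{ intros s Hs; unfold df, de, dissipation, D.
  pose proof (hod_U1 HU x s Hs); pose proof (hod_U1 HV x s Hs); field; lra. }
assert (If : is_RInt (df x) d (Q - d) (W x (Q - d) * D x (Q - d) - W x d * D x d)).
{ apply is_RInt_ext with (fun s => df x s); [reflexivity|].
  (* The derivatives of the speeds in [s] are not part of [hodograph], so [W * D] is differentiated
     with [D] in its pressure form, whose derivative is [G - L]. *)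
  rewrite <- 2!(pressure_difference x) by lra.
  apply (is_RInt_derive (V := R_CompleteNormedModule)
    (fun s => W x s * (P x s - R' x s - k)) (df x)).
  - intros s Hs; rewrite Rmin_left, Rmax_right in Hs by lra.
    unfold df; rewrite <- pressure_difference by lra.
    apply (is_derive_mult (K := R_AbsRing) (fun s => W x s)
      (fun s => P x s - R' x s - k)); [| |intros; apply Rmult_comm].
    + apply (is_derive_minus (V := R_NormedModule));
        [apply (hod_Y_s HU) | apply (hod_Y_s HV)]; lra.
    + replace (G x s - L x s) with (G x s - L x s - 0) by ring.
      apply (is_derive_minus (V := R_NormedModule)); [|apply (is_derive_const (V := R_NormedModule))].
      apply (is_derive_minus (V := R_NormedModule));
        [apply (hod_P_s HU) | apply (hod_P_s HV)]; lra.
  - intros s Hs; rewrite Rmin_left, Rmax_right in Hs by lra.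
    apply continuous_ext_loc with (fun s => dissipation x s - de x s).
    + assert (He : 0 < Rmin s (Q - s)) by (apply Rmin_glb_lt; lra).
      exists (mkposreal _ He); simpl; intros r Hr; symmetry; apply E.
      pose proof (Rmin_l s (Q - s)); pose proof (Rmin_r s (Q - s)).
      change (Rabs (r - s) < Rmin s (Q - s)) in Hr; apply Rabs_def2 in Hr; lra.
    + apply (continuity_2d_pt_continuous_2 (fun x s => dissipation x s - de x s)).
      apply continuity_2d_pt_minus; [apply dissipation_cont | apply cde]; lra. }
replace (_ - _) with (RInt (fun s => de x s) d (Q - d)).
- apply (is_derive_RInt_strip _ de 0 Q); try lra; auto.
  + intros y s Hs.
    apply (is_derive_mult (K := R_AbsRing) (fun t => W t s)
      (fun t => U2 t s - V2 t s)); [| |intros; apply Rmult_comm].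
    * apply (is_derive_minus (V := R_NormedModule));
        [now apply (hod_Y_x HU) | now apply (hod_Y_x HV)].
    * apply (is_derive_minus (V := R_NormedModule));
        [now apply (hod_U2_x HU) | now apply (hod_U2_x HV)].
  + intros y s Hs; apply continuity_2d_pt_mult; auto.
- rewrite <- (is_RInt_unique _ _ _ _ If).
  rewrite <- (RInt_minus (V := R_CompleteNormedModule)).
  + apply RInt_ext; intros s Hs; rewrite Rmin_left, Rmax_right in Hs by lra.
    rewrite (E s) by lra; unfold minus, plus, opp; simpl; ring.
  + apply ex_RInt_strip with 0 Q; try lra; intros; now apply dissipation_cont.
  + eexists; apply If.
Qed.

Lemma height_difference_le (x s : R) : 0 < s < Q -> Rabs (W x s) <= H.
Proof.
intros Hs; pose proof (hod_Y HU x s Hs); pose proof (hod_Y HV x s Hs).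
pose proof (height x); unfold W; apply Rabs_le; lra.
Qed.

Lemma energy_integrand_cont (x s : R) : 0 < s < Q ->
  continuity_2d_pt (fun x s => W x s * (U2 x s - V2 x s)) x s.
Proof.
intros Hs; apply continuity_2d_pt_mult; apply continuity_2d_pt_minus;
[apply (hod_Y_cont HU)|apply (hod_Y_cont HV)
|apply (hod_U2_cont HU)|apply (hod_U2_cont HV)]; assumption.
Qed.

(** Uniform in [d] and [x]: this is the bound that a steadily growing energy would violate. *)
Lemma energy_bounded (d x : R) : 0 < d -> d <= Q - d ->
  Rabs (energy d x) <= Q * (H * (2 * K)).
Proof.
intros Hd HdQ.
assert (0 <= H) by
  (apply Rle_trans with (Rabs (W x d));
   [apply Rabs_pos | apply height_difference_le; lra]).
assert (0 <= K) by (pose proof (hod_U1 HU x d ltac:(lra)); lra).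
apply Rle_trans with ((Q - d - d) * (H * (2 * K))).
- apply abs_RInt_le_const; [assumption| |].
  + apply (ex_RInt_strip (fun x s => W x s * (U2 x s - V2 x s)) 0 Q); try lra.
    apply energy_integrand_cont.
  + intros s Hs; rewrite Rabs_mult.
    apply Rmult_le_compat; try apply Rabs_pos; [apply height_difference_le; lra|].
    pose proof (proj1 (Rabs_le_between _ _) (hod_U2 HU x s ltac:(lra))).
    pose proof (proj1 (Rabs_le_between _ _) (hod_U2 HV x s ltac:(lra))).
    apply Rabs_le; lra.
- apply Rmult_le_compat_r; [|lra].
  apply Rmult_le_pos; lra.
Qed.

Lemma height_difference_small_at_walls (T eps : R) : 0 < eps ->
  exists d0, 0 < d0 /\ forall d x, 0 < d < d0 -> d < Q -> Rabs x <= T ->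
    Rabs (W x d) <= eps /\ Rabs (W x (Q - d)) <= eps.
Proof.
intros He.
destruct (hod_walls HU T eps He) as [d1 [Hd1 W1]].
destruct (hod_walls HV T eps He) as [d2 [Hd2 W2]].
exists (Rmin d1 d2); split; [now apply Rmin_glb_lt|].
intros d x Hd HdQ Hx; pose proof (Rmin_l d1 d2); pose proof (Rmin_r d1 d2).
destruct (W1 d x) as [A1 A2]; try lra; destruct (W2 d x) as [A3 A4]; try lra.
pose proof (hod_Y HU x d); pose proof (hod_Y HV x d).
pose proof (hod_Y HU x (Q - d)); pose proof (hod_Y HV x (Q - d)).
unfold W; split; apply Rabs_le; lra.
Qed.

(** Close to a wall both heights are squeezed against the same boundary, so [W] is small, while [D]
    is at most [K ^ 2] in absolute value. The threshold [d0] depends on [T], so it serves only a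
    bounded range of [x]. *)
Lemma wall_flux_small (T eps : R) : 0 < eps ->
  exists d0, 0 < d0 /\ forall d x, 0 < d < d0 -> d <= Q - d -> Rabs x <= T ->
    Rabs (W x (Q - d) * D x (Q - d) - W x d * D x d) <= eps.
Proof.
intros He; pose proof (pow2_ge_0 K).
assert (Hc : 0 < 2 * K ^ 2 + 1) by lra.
destruct (height_difference_small_at_walls T (eps / (2 * K ^ 2 + 1)))
  as [d0 [Hd0 HW]]; [now apply Rdiv_lt_0_compat|].
exists d0; split; [assumption|]; intros d x Hd HdQ Hx.
destruct (HW d x Hd ltac:(lra) Hx) as [A1 A2].
assert (bD : forall s, 0 < s < Q -> Rabs (D x s) <= K ^ 2).
{ intros s Hs.
  assert (sq : forall r, Rabs r <= K -> 0 <= r ^ 2 <= K ^ 2).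
  { intros r Hr; split; [apply pow2_ge_0|]; rewrite <- (pow2_abs r).
    apply pow_incr; split; [apply Rabs_pos | assumption]. }
  pose proof (sq _ (hod_U2 HU x s Hs)); pose proof (sq _ (hod_U2 HV x s Hs)).
  destruct (hod_U1 HU x s Hs); destruct (hod_U1 HV x s Hs).
  assert (0 <= U1 x s ^ 2 <= K ^ 2) by (apply sq; rewrite Rabs_pos_eq; lra).
  assert (0 <= V1 x s ^ 2 <= K ^ 2) by (apply sq; rewrite Rabs_pos_eq; lra).
  unfold D; apply Rabs_le; lra. }
set (e := eps / (2 * K ^ 2 + 1)) in *.
assert (He' : eps = e * (2 * K ^ 2 + 1)) by (unfold e; field; lra).
assert (0 < e) by (apply Rdiv_lt_0_compat; lra).
assert (Rabs (W x (Q - d) * D x (Q - d)) <= e * K ^ 2).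
{ rewrite Rabs_mult; apply Rmult_le_compat; try apply Rabs_pos;
  [assumption | apply bD; lra]. }
assert (Rabs (W x d * D x d) <= e * K ^ 2).
{ rewrite Rabs_mult; apply Rmult_le_compat; try apply Rabs_pos;
  [assumption | apply bD; lra]. }
rewrite He'; eapply Rle_trans; [apply Rabs_triang|]; rewrite Rabs_Ropp; lra.
Qed.

(** The Cauchy-Schwarz inequality for the energy integral, in Young's form with weight [mu]: the
    product of [W] and [U2 - V2] is split into a multiple of [(U2 - V2) ^ 2], controlled by [K]
    times the dissipation, and a constant. *)
Lemma dissipation_ge_of_energy (d x eps : R) : 0 < d -> d <= Q - d -> 0 < eps ->
  eps <= Rabs (energy d x) ->
  eps ^ 2 / ((H + 1) ^ 2 * Q * K) <= RInt (fun s => dissipation x s) d (Q - d).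
Proof.
intros Hd HdQ He HE.
assert (HQ : 0 < Q) by lra.
assert (HK : 0 < K) by (pose proof (hod_U1 HU x d ltac:(lra)); lra).
assert (HH : 0 <= H) by
  (apply Rle_trans with (Rabs (W x d));
   [apply Rabs_pos | apply height_difference_le; lra]).
(* Taking [H + 1] instead of [H] keeps [N] positive even if the bound [H] is zero. *)
set (N := (H + 1) ^ 2 * Q).
assert (HN : 0 < N) by (unfold N; apply Rmult_lt_0_compat; [apply pow_lt|]; lra).
set (m := RInt _ _ _).
(* With this weight the constant term of Young's inequality integrates to at most [eps / 2], half of
   the assumed lower bound on the energy. *)
set (mu := N / eps).
assert (Hmu : 0 < mu) by (unfold mu; now apply Rdiv_lt_0_compat).
assert (Idis : ex_RInt (fun s => dissipation x s) d (Q - d)).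
{ apply ex_RInt_strip with 0 Q; try lra; intros; now apply dissipation_cont. }
assert (Ien : ex_RInt (fun s => W x s * (U2 x s - V2 x s)) d (Q - d)).
{ apply (ex_RInt_strip (fun x s => W x s * (U2 x s - V2 x s)) 0 Q); try lra.
  apply energy_integrand_cont. }
assert (L1 : Rabs (energy d x) <= (mu * K / 2) * m + (Q - d - d) * ((H + 1) ^ 2 / mu / 2)).
{ eapply Rle_trans; [apply abs_RInt_le; assumption|].
  apply Rle_trans with
    (RInt (fun s => plus (scal (mu * K / 2) (dissipation x s)) ((H + 1) ^ 2 / mu / 2))
       d (Q - d)).
  - apply RInt_le; [assumption| | |].
    + exact (ex_RInt_norm _ _ _ Ien).
    + apply (ex_RInt_plus (V := R_NormedModule));
        [now apply (ex_RInt_scal (V := R_NormedModule))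
        |apply (ex_RInt_const (V := R_NormedModule))].
    + intros s Hs.
      assert (A1 := height_difference_le x s ltac:(lra)).
      assert (A2 := dissipation_ge x s ltac:(lra)).
      set (w := W x s) in *; set (e := U2 x s - V2 x s) in *.
      pose proof (pow2_ge_0 (U1 x s - V1 x s)).
      assert (A3 : e ^ 2 <= K * dissipation x s).
      { apply Rle_trans with (K * (((U1 x s - V1 x s) ^ 2 + e ^ 2) / K)).
        - replace (K * _) with ((U1 x s - V1 x s) ^ 2 + e ^ 2) by (field; lra); lra.
        - apply Rmult_le_compat_l; lra. }
      assert (A4 : 0 <= (mu * Rabs e - (H + 1)) ^ 2 / mu).
      { apply Rmult_le_pos; [apply pow2_ge_0 | now apply Rlt_le, Rinv_0_lt_compat]. }
      replace ((mu * Rabs e - (H + 1)) ^ 2 / mu)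
        with (mu * Rabs e ^ 2 - 2 * (H + 1) * Rabs e + (H + 1) ^ 2 / mu) in A4
        by (field; lra).
      rewrite (pow2_abs e) in A4.
      rewrite Rabs_mult; pose proof (Rabs_pos e).
      assert (Rabs w * Rabs e <= (H + 1) * Rabs e)
        by (apply Rmult_le_compat_r; lra).
      assert (mu * e ^ 2 <= mu * (K * dissipation x s))
        by (apply Rmult_le_compat_l; lra).
      unfold plus, scal, mult; simpl; unfold mult; simpl; simpl in *; lra.
  - rewrite (RInt_plus (V := R_CompleteNormedModule)).
    + rewrite (RInt_scal (V := R_CompleteNormedModule)) by assumption.
      rewrite RInt_const; right; reflexivity.
    + now apply (ex_RInt_scal (V := R_NormedModule)).
    + apply (ex_RInt_const (V := R_NormedModule)). }
assert (L2 : (Q - d - d) * ((H + 1) ^ 2 / mu / 2) <= eps / 2).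
{ replace (eps / 2) with (Q * ((H + 1) ^ 2 / mu / 2)).
  - apply Rmult_le_compat_r; [|lra].
    apply Rmult_le_pos; [|lra]; apply Rmult_le_pos; [apply pow2_ge_0|].
    now apply Rlt_le, Rinv_0_lt_compat.
  - unfold mu, N; field; lra. }
apply Rmult_le_reg_l with (mu * K / 2); [apply Rmult_lt_0_compat; [apply Rmult_lt_0_compat|]; lra|].
replace (mu * K / 2 * (eps ^ 2 / (N * K))) with (eps / 2);
  [lra | unfold mu; field; lra].
Qed.

(** Where the energy is at least [eps / 2] in absolute value, the dissipation gives a slope of at
    least [g], and small wall fluxes cost at most half of it. An energy of size [eps] at [x0] would
    then grow linearly, to the right if positive and to the left if negative, and leave its bounds
    within distance [T]. *)
Lemma energy_vanishes (x0 eps : R) : 0 < eps -> 0 < Q -> exists d0, 0 < d0 /\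
  forall d, 0 < d < d0 -> d <= Q - d -> Rabs (energy d x0) < eps.
Proof.
intros He HQ.
assert (HK : 0 < K) by (pose proof (hod_U1 HU x0 (Q / 2) ltac:(lra)); lra).
assert (HH : 0 <= H) by
  (apply Rle_trans with (Rabs (W x0 (Q / 2)));
   [apply Rabs_pos | apply height_difference_le; lra]).
set (N := (H + 1) ^ 2 * Q * K).
assert (HN : 0 < N).
{ unfold N; apply Rmult_lt_0_compat; [apply Rmult_lt_0_compat|]; trivial.
  apply pow_lt; lra. }
set (g := (eps / 2) ^ 2 / N).
assert (Hg : 0 < g) by (apply Rdiv_lt_0_compat; [apply pow_lt|]; lra).
set (C := Q * (H * (2 * K))).
assert (HC : 0 <= C) by (unfold C; repeat apply Rmult_le_pos; lra).
(* At slope [g / 2] the energy changes by [C + 1] over the length [T]. *)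
set (T := 2 * (C + 1) / g).
assert (HT : g / 2 * T = C + 1) by (unfold T; field; lra).
assert (HT0 : 0 < T) by (unfold T; apply Rdiv_lt_0_compat; lra).
(* The first bound leaves the slope [g / 2]. The second limits any decrease over the length [T] to
   [eps / 2], so an energy that starts at [eps] never drops below the level [eps / 2] at which the
   slope estimate applies. *)
set (eta := Rmin (g / 2) (eps / 2 / T)).
assert (Heta : 0 < eta).
{ apply Rmin_glb_lt; [lra|]; apply Rdiv_lt_0_compat; lra. }
assert (Heta1 : eta <= g / 2) by apply Rmin_l.
assert (Heta2 : eta * T <= eps / 2).
{ apply Rle_trans with (eps / 2 / T * T);
  [apply Rmult_le_compat_r; [lra | apply Rmin_r] | right; field; lra]. }
destruct (wall_flux_small (Rabs x0 + T) eta Heta) as [d0 [Hd0 Hfl]].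
exists d0; split; [assumption|]; intros d Hd HdQ.
pose (de := fun x => RInt (fun s => dissipation x s) d (Q - d)
     - (W x (Q - d) * D x (Q - d) - W x d * D x d)).
assert (Hde : forall x, is_derive (energy d) x (de x)).
{ intros x; apply is_derive_energy; lra. }
assert (Hx : forall x, Rabs (x - x0) <= T -> Rabs x <= Rabs x0 + T).
{ intros x Hx; replace x with (x0 + (x - x0)) by ring.
  eapply Rle_trans; [apply Rabs_triang|]; lra. }
assert (low : forall x, Rabs (x - x0) <= T -> - eta <= de x).
{ intros x Hxx; assert (A := Hfl d x Hd HdQ (Hx x Hxx)).
  apply Rabs_le_between in A.
  assert (0 <= RInt (fun s => dissipation x s) d (Q - d)).
  { apply RInt_ge_0; [assumption| |].
    - apply ex_RInt_strip with 0 Q; try lra; intros; now apply dissipation_cont.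
    - intros s Hs; apply Rle_trans with (2 := dissipation_ge x s ltac:(lra)).
      apply Rmult_le_pos; [|now apply Rlt_le, Rinv_0_lt_compat].
      apply Rplus_le_le_0_compat; apply pow2_ge_0. }
  unfold de; lra. }
assert (high : forall x, Rabs (x - x0) <= T -> eps / 2 <= Rabs (energy d x) ->
  g / 2 <= de x).
{ intros x Hxx HE; assert (A := Hfl d x Hd HdQ (Hx x Hxx)).
  apply Rabs_le_between in A.
  assert (A' := dissipation_ge_of_energy d x (eps / 2) ltac:(lra) HdQ ltac:(lra) HE).
  fold N g in A'; unfold de; lra. }
assert (bnd : forall x, - C <= energy d x <= C).
{ intros x; apply Rabs_le_between, energy_bounded; lra. }
apply Rnot_le_lt; intros HE.
destruct (Rle_or_lt 0 (energy d x0)) as [Hs|Hs].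
- rewrite Rabs_pos_eq in HE by assumption.
  assert (up : forall x, x0 <= x <= x0 + T -> eps / 2 <= energy d x).
  { intros x Hxx.
    assert (A := increment_ge (energy d) de x0 x (- eta) ltac:(lra) (fun y _ => Hde y)).
    assert (A' : - eta * (x - x0) <= energy d x - energy d x0).
    { apply A; intros y Hy; apply low, Rabs_le; lra. }
    nra. }
  assert (A : g / 2 * (x0 + T - x0) <= energy d (x0 + T) - energy d x0).
  { apply (increment_ge (energy d) de); [lra | auto|].
    intros y Hy; apply high; [apply Rabs_le; lra|].
    eapply Rle_trans; [|apply Rle_abs]; now apply up. }
  pose proof (bnd (x0 + T)); nra.
- rewrite Rabs_left in HE by assumption.
  assert (up : forall x, x0 - T <= x <= x0 -> eps / 2 <= - energy d x).
  { intros x Hxx.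
    assert (A := increment_ge (energy d) de x x0 (- eta) ltac:(lra) (fun y _ => Hde y)).
    assert (A' : - eta * (x0 - x) <= energy d x0 - energy d x).
    { apply A; intros y Hy; apply low, Rabs_le; lra. }
    nra. }
  assert (A : g / 2 * (x0 - (x0 - T)) <= energy d x0 - energy d (x0 - T)).
  { apply (increment_ge (energy d) de); [lra | auto|].
    intros y Hy; apply high; [apply Rabs_le; lra|].
    rewrite <- Rabs_Ropp; eapply Rle_trans; [|apply Rle_abs]; now apply up. }
  pose proof (bnd (x0 - T)); nra.
Qed.

(** A positive dissipation at one point persists on a square around it and forces the energy to
    increase by a fixed amount across that square, for all small [d]. This contradicts the vanishing
    of the energy on both sides. *)
Lemma velocities_agree (x0 s0 : R) : 0 < s0 < Q ->
  U1 x0 s0 = V1 x0 s0 /\ U2 x0 s0 = V2 x0 s0.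
Proof.
intros Hs0.
assert (HK : 0 < K) by (pose proof (hod_U1 HU x0 s0 Hs0); lra).
assert (pos : forall x s, 0 < s < Q -> 0 <= dissipation x s).
{ intros x s Hs; apply Rle_trans with (2 := dissipation_ge x s Hs).
  apply Rmult_le_pos; [|now apply Rlt_le, Rinv_0_lt_compat].
  apply Rplus_le_le_0_compat; apply pow2_ge_0. }
enough (Z0 : dissipation x0 s0 <= 0).
{ assert (A := dissipation_ge x0 s0 Hs0).
  pose proof (pow2_ge_0 (U1 x0 s0 - V1 x0 s0)) as P1.
  pose proof (pow2_ge_0 (U2 x0 s0 - V2 x0 s0)) as P2.
  set (S := (U1 x0 s0 - V1 x0 s0) ^ 2 + (U2 x0 s0 - V2 x0 s0) ^ 2) in *.
  assert (S <= 0).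
  { apply Rmult_le_reg_r with (/ K); [now apply Rinv_0_lt_compat|].
    unfold Rdiv in A; lra. }
  assert (E1 : (U1 x0 s0 - V1 x0 s0) ^ 2 = 0) by (unfold S in *; lra).
  assert (E2 : (U2 x0 s0 - V2 x0 s0) ^ 2 = 0) by (unfold S in *; lra).
  rewrite <- Rsqr_pow2 in E1; apply Rsqr_eq_0 in E1.
  rewrite <- Rsqr_pow2 in E2; apply Rsqr_eq_0 in E2; lra. }
apply Rnot_lt_le; intros Hpos.
set (m := dissipation x0 s0 / 2).
assert (Hm : 0 < m) by (unfold m; lra).
destruct (dissipation_cont x0 s0 Hs0 (mkposreal m Hm)) as [r0 Hr0]; simpl in Hr0.
pose proof (cond_pos r0) as r0_pos.
set (r := Rmin r0 (Rmin s0 (Q - s0)) / 2).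
assert (Hr : 0 < Rmin r0 (Rmin s0 (Q - s0)))
  by (repeat apply Rmin_glb_lt; lra).
assert (r <= r0 / 2 /\ r <= s0 / 2 /\ r <= (Q - s0) / 2) as [R1 [R2 R3]].
{ unfold r; pose proof (Rmin_l r0 (Rmin s0 (Q - s0))).
  pose proof (Rmin_r r0 (Rmin s0 (Q - s0))).
  pose proof (Rmin_l s0 (Q - s0)); pose proof (Rmin_r s0 (Q - s0)); lra. }
assert (r_pos : 0 < r) by (unfold r; lra).
assert (near : forall x s, Rabs (x - x0) <= r -> Rabs (s - s0) <= r ->
  m <= dissipation x s).
{ intros x s Hx Hs; assert (A := Hr0 x s ltac:(lra) ltac:(lra)).
  apply Rabs_def2 in A; unfold m in *; lra. }
(* The balance is as follows: the square contributes [2 * r * m] to the slope and the wall flux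
   takes at most [r * m], so over the length [2 * r] the energy gains at least [2 * r * r * m]. Two
   values smaller than [r * r * m] cannot differ by that much. *)
assert (He : 0 < r * r * m) by (apply Rmult_lt_0_compat; [apply Rmult_lt_0_compat|]; assumption).
destruct (energy_vanishes (x0 + r) _ He ltac:(lra)) as [d1 [Hd1 E1]].
destruct (energy_vanishes (x0 - r) _ He ltac:(lra)) as [d2 [Hd2 E2]].
destruct (wall_flux_small (Rabs x0 + r) (r * m)) as [d3 [Hd3 E3]];
  [now apply Rmult_lt_0_compat|].
(* The last entry ensures that [[s0 - r, s0 + r]] lies in [[d, Q - d]]. *)
set (d := Rmin (Rmin d1 d2) (Rmin d3 (Rmin s0 (Q - s0) / 2)) / 2).
assert (Hrr : 0 < Rmin s0 (Q - s0)) by (apply Rmin_glb_lt; lra).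
assert (d_pos : 0 < Rmin (Rmin d1 d2) (Rmin d3 (Rmin s0 (Q - s0) / 2)))
  by (repeat apply Rmin_glb_lt; lra).
assert (d < d1 /\ d < d2 /\ d < d3 /\ d <= s0 / 4 /\ d <= (Q - s0) / 4)
  as [D1 [D2 [D3 [D4 D5]]]].
{ unfold d; pose proof (Rmin_l (Rmin d1 d2) (Rmin d3 (Rmin s0 (Q - s0) / 2))).
  pose proof (Rmin_r (Rmin d1 d2) (Rmin d3 (Rmin s0 (Q - s0) / 2))).
  pose proof (Rmin_l d1 d2); pose proof (Rmin_r d1 d2).
  pose proof (Rmin_l d3 (Rmin s0 (Q - s0) / 2)).
  pose proof (Rmin_r d3 (Rmin s0 (Q - s0) / 2)).
  pose proof (Rmin_l s0 (Q - s0)); pose proof (Rmin_r s0 (Q - s0)); lra. }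
assert (d_pos' : 0 < d) by (unfold d; lra).
assert (A : r * m * (x0 + r - (x0 - r)) <= energy d (x0 + r) - energy d (x0 - r)).
{ apply (increment_ge _ (fun x => RInt (fun s => dissipation x s) d (Q - d)
     - (W x (Q - d) * D x (Q - d) - W x d * D x d))); [lra| |].
  - intros x Hx; apply is_derive_energy; lra.
  - intros x Hx.
    assert (F : Rabs x <= Rabs x0 + r).
    { replace x with (x0 + (x - x0)) by ring.
      eapply Rle_trans; [apply Rabs_triang|].
      apply Rplus_le_compat_l, Rabs_le; lra. }
    assert (A := E3 d x ltac:(lra) ltac:(lra) F); apply Rabs_le_between in A.
    assert (ex : forall a b, 0 < a -> a <= b -> b < Q ->
      ex_RInt (fun s => dissipation x s) a b).
    { intros a b Ha Hab Hb; apply ex_RInt_strip with 0 Q; try lra.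
      intros; now apply dissipation_cont. }
    rewrite <- (RInt_Chasles _ d (s0 - r)), <- (RInt_Chasles _ (s0 - r) (s0 + r))
      by (apply ex; lra).
    assert (G1 : 0 <= RInt (fun s => dissipation x s) d (s0 - r)).
    { apply RInt_ge_0; [lra | apply ex; lra | intros; apply pos; lra]. }
    assert (G2 : 0 <= RInt (fun s => dissipation x s) (s0 + r) (Q - d)).
    { apply RInt_ge_0; [lra | apply ex; lra | intros; apply pos; lra]. }
    assert (G3 : (s0 + r - (s0 - r)) * m
      <= RInt (fun s => dissipation x s) (s0 - r) (s0 + r)).
    { replace (_ * m) with (RInt (fun _ => m) (s0 - r) (s0 + r))
        by (rewrite RInt_const; reflexivity).
      apply RInt_le; [lra | apply ex_RInt_const | apply ex; lra|].
      intros s Hs; apply near; apply Rabs_le; lra. }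
    unfold plus; simpl; lra. }
assert (B1 := E1 d ltac:(lra) ltac:(lra)); apply Rabs_def2 in B1.
assert (B2 := E2 d ltac:(lra) ltac:(lra)); apply Rabs_def2 in B2.
lra.
Qed.

(** Equal speeds make [W x] constant in [s], and [W x] tends to zero at the lower wall. *)
Lemma heights_agree (x s : R) : 0 < s < Q -> Y x s = Z x s.
Proof.
intros Hs; enough (A : forall eps, 0 < eps -> Rabs (W x s) <= eps).
{ apply Rminus_diag_uniq; change (W x s = 0).
  destruct (Req_dec (W x s) 0) as [E|E]; [exact E|exfalso].
  apply Rabs_pos_lt in E; specialize (A (Rabs (W x s) / 2) ltac:(lra)); lra. }
intros eps He.
destruct (height_difference_small_at_walls (Rabs x) eps He) as [d0 [Hd0 Hd]].
set (d := Rmin d0 s / 2).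
assert (0 < Rmin d0 s) by (apply Rmin_glb_lt; lra).
assert (0 < d /\ d < d0 /\ d < s) as [D0 [D1 D2]].
{ unfold d; pose proof (Rmin_l d0 s); pose proof (Rmin_r d0 s); lra. }
destruct (Hd d x ltac:(lra) ltac:(lra) (Rle_refl _)) as [A _].
assert (I : Rabs (W x s - W x d) <= 0 * Rabs (s - d)).
{ apply (increment_abs_le (W x) (fun s => / U1 x s - / V1 x s));
  intros t Ht; rewrite Rmin_left, Rmax_right in Ht by lra.
  - apply (is_derive_minus (V := R_NormedModule));
    [apply (hod_Y_s HU) | apply (hod_Y_s HV)]; lra.
  - destruct (velocities_agree x t ltac:(lra)) as [E _].
    rewrite E, Rminus_diag, Rabs_R0; lra. }
replace (W x s) with (W x d + (W x s - W x d)) by ring.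
eapply Rle_trans; [apply Rabs_triang|]; lra.
Qed.

End Comparison.

(** * Streamline coordinates of one flow *)

(** The primitive of the upstream profile [6 * Q * y * (1 - y)] that vanishes at [y = 0]. Its value
    at [y = 1] is [Q], which identifies [Q] as the total flux. *)
Definition poiseuille_flux (Q y : R) : R := Q * (3 * y ^ 2 - 2 * y ^ 3).

(** The inverse of [poiseuille_flux Q], by choice; it is meaningful for [0 < s < Q] only. *)
Definition poiseuille_height (Q s : R) : R :=
  epsilon (inhabits 0) (fun y => 0 < y < 1 /\ poiseuille_flux Q y = s).

(** The upstream speed on the streamline of flux [s]. It depends on [Q] alone, which is how two
    flows come to share the function [c] of [hodograph]. *)
Definition poiseuille_speed (Q s : R) : R :=
  6 * Q * poiseuille_height Q s * (1 - poiseuille_height Q s).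

Lemma poiseuille_height_spec (Q s : R) : 0 < s < Q ->
  0 < poiseuille_height Q s < 1 /\ poiseuille_flux Q (poiseuille_height Q s) = s.
Proof.
intros Hs.
apply (epsilon_spec (inhabits 0) (fun y => 0 < y < 1 /\ poiseuille_flux Q y = s)).
assert (E0 : poiseuille_flux Q 0 = 0) by (unfold poiseuille_flux; ring).
assert (E1 : poiseuille_flux Q 1 = Q) by (unfold poiseuille_flux; ring).
destruct (IVT_gen_consistent (poiseuille_flux Q) 0 1 s) as [y [Hy E]].
- intros y; apply (ex_derive_continuous (V := R_NormedModule)).
  unfold poiseuille_flux; auto_derive; trivial.
- rewrite E0, E1, Rmin_left, Rmax_right; lra.
- rewrite Rmin_left, Rmax_right in Hy by lra.
  exists y; split; [|assumption]; split; apply Rnot_le_lt; intros Hle.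
  + replace y with 0 in E by lra; lra.
  + replace y with 1 in E by lra; lra.
Qed.

Lemma poiseuille_flux_lt (Q y z : R) : 0 < Q -> 0 < y -> y < z -> z < 1 ->
  poiseuille_flux Q y < poiseuille_flux Q z.
Proof.
intros HQ Hy Hyz Hz; unfold poiseuille_flux; apply Rmult_lt_compat_l; [assumption|].
enough (0 < (z - y) * (3 * (z + y) - 2 * (z ^ 2 + z * y + y ^ 2))) by lra.
apply Rmult_lt_0_compat; [lra | nra].
Qed.

(* The data of one flow, in curried form: [H] bounds the geometry and [M] is both a bound and a Lipschitz constant for the velocity. *)
Record channel_flow (h0 h1 dh0 dh1 : R -> R) (H M Q Lm : R)
    (u1 u2 p u1x u1y u2x u2y px py : R -> R -> R) : Prop := {
  cf_h0 : forall x, is_derive h0 x (dh0 x);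
  cf_h1 : forall x, is_derive h1 x (dh1 x);
  cf_lt : forall x, h0 x < h1 x;
  cf_height : forall x, h1 x - h0 x <= H;
  cf_dh : forall x, Rabs (dh1 x - dh0 x) <= H /\ Rabs (dh0 x) <= H /\ Rabs (dh1 x) <= H;
  cf_inlet : forall x, x <= Lm -> h0 x = 0 /\ h1 x = 1;
  cf_u1_bound : forall x y, h0 x <= y <= h1 x -> Rabs (u1 x y) <= M;
  cf_u2_bound : forall x y, h0 x <= y <= h1 x -> Rabs (u2 x y) <= M;
  cf_u1_lip : forall x y x' y', h0 x <= y <= h1 x -> h0 x' <= y' <= h1 x' ->
    Rabs (u1 x y - u1 x' y') <= M * (Rabs (x - x') + Rabs (y - y'));
  cf_u2_lip : forall x y x' y', h0 x <= y <= h1 x -> h0 x' <= y' <= h1 x' ->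
    Rabs (u2 x y - u2 x' y') <= M * (Rabs (x - x') + Rabs (y - y'));
  cf_slip0 : forall x, u2 x (h0 x) = u1 x (h0 x) * dh0 x;
  cf_slip1 : forall x, u2 x (h1 x) = u1 x (h1 x) * dh1 x;
  cf_pos : forall x y, h0 x < y < h1 x -> 0 < u1 x y;
  cf_u1_diff : forall x y, h0 x < y < h1 x ->
    differentiable_pt_lim u1 x y (u1x x y) (u1y x y);
  cf_u2_diff : forall x y, h0 x < y < h1 x ->
    differentiable_pt_lim u2 x y (u2x x y) (u2y x y);
  cf_p_diff : forall x y, h0 x < y < h1 x ->
    differentiable_pt_lim p x y (px x y) (py x y);
  cf_u1x_cont : forall x y, h0 x < y < h1 x -> continuity_2d_pt u1x x y;
  cf_u2y_cont : forall x y, h0 x < y < h1 x -> continuity_2d_pt u2y x y;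
  cf_py_cont : forall x y, h0 x < y < h1 x -> continuity_2d_pt py x y;
  cf_div : forall x y, h0 x < y < h1 x -> u1x x y + u2y x y = 0;
  cf_momentum1 : forall x y, h0 x < y < h1 x ->
    u1 x y * u1x x y + u2 x y * u1y x y + px x y = 0;
  cf_momentum2 : forall x y, h0 x < y < h1 x ->
    u1 x y * u2x x y + u2 x y * u2y x y + py x y = 0;
  cf_upstream : forall eps, 0 < eps -> exists N, forall x y, x < N -> 0 <= y <= 1 ->
    Rabs (u1 x y - 6 * Q * y * (1 - y)) < eps
}.

Arguments cf_h0 {h0 h1 dh0 dh1 H M Q Lm u1 u2 p u1x u1y u2x u2y px py} _.
Arguments cf_h1 {h0 h1 dh0 dh1 H M Q Lm u1 u2 p u1x u1y u2x u2y px py} _.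
Arguments cf_lt {h0 h1 dh0 dh1 H M Q Lm u1 u2 p u1x u1y u2x u2y px py} _.
Arguments cf_height {h0 h1 dh0 dh1 H M Q Lm u1 u2 p u1x u1y u2x u2y px py} _.
Arguments cf_dh {h0 h1 dh0 dh1 H M Q Lm u1 u2 p u1x u1y u2x u2y px py} _.
Arguments cf_inlet {h0 h1 dh0 dh1 H M Q Lm u1 u2 p u1x u1y u2x u2y px py} _.
Arguments cf_u1_bound {h0 h1 dh0 dh1 H M Q Lm u1 u2 p u1x u1y u2x u2y px py} _.
Arguments cf_u2_bound {h0 h1 dh0 dh1 H M Q Lm u1 u2 p u1x u1y u2x u2y px py} _.
Arguments cf_u1_lip {h0 h1 dh0 dh1 H M Q Lm u1 u2 p u1x u1y u2x u2y px py} _.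
Arguments cf_u2_lip {h0 h1 dh0 dh1 H M Q Lm u1 u2 p u1x u1y u2x u2y px py} _.
Arguments cf_slip0 {h0 h1 dh0 dh1 H M Q Lm u1 u2 p u1x u1y u2x u2y px py} _.
Arguments cf_slip1 {h0 h1 dh0 dh1 H M Q Lm u1 u2 p u1x u1y u2x u2y px py} _.
Arguments cf_pos {h0 h1 dh0 dh1 H M Q Lm u1 u2 p u1x u1y u2x u2y px py} _.
Arguments cf_u1_diff {h0 h1 dh0 dh1 H M Q Lm u1 u2 p u1x u1y u2x u2y px py} _.
Arguments cf_u2_diff {h0 h1 dh0 dh1 H M Q Lm u1 u2 p u1x u1y u2x u2y px py} _.
Arguments cf_p_diff {h0 h1 dh0 dh1 H M Q Lm u1 u2 p u1x u1y u2x u2y px py} _.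
Arguments cf_u1x_cont {h0 h1 dh0 dh1 H M Q Lm u1 u2 p u1x u1y u2x u2y px py} _.
Arguments cf_u2y_cont {h0 h1 dh0 dh1 H M Q Lm u1 u2 p u1x u1y u2x u2y px py} _.
Arguments cf_py_cont {h0 h1 dh0 dh1 H M Q Lm u1 u2 p u1x u1y u2x u2y px py} _.
Arguments cf_div {h0 h1 dh0 dh1 H M Q Lm u1 u2 p u1x u1y u2x u2y px py} _.
Arguments cf_momentum1 {h0 h1 dh0 dh1 H M Q Lm u1 u2 p u1x u1y u2x u2y px py} _.
Arguments cf_momentum2 {h0 h1 dh0 dh1 H M Q Lm u1 u2 p u1x u1y u2x u2y px py} _.
Arguments cf_upstream {h0 h1 dh0 dh1 H M Q Lm u1 u2 p u1x u1y u2x u2y px py} _.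

Section Channel.

Variables (h0 h1 dh0 dh1 : R -> R) (H M Q Lm : R).
Variables (u1 u2 p u1x u1y u2x u2y px py : R -> R -> R).
Hypothesis CF : channel_flow h0 h1 dh0 dh1 H M Q Lm u1 u2 p u1x u1y u2x u2y px py.

(** * The stream function *)

Let lt01 := cf_lt CF.
(** The stream function, normalised to vanish on the lower wall. Its derivative in [y] is immediate;
    the one in [x], proved in [is_derive_psi_1], needs incompressibility and the slip condition. *)
Let psi x y : R := RInt (u1 x) (h0 x) y.

Lemma speed_bound_nonneg : 0 <= M.
Proof.
apply Rle_trans with (Rabs (u1 0 (h0 0))); [apply Rabs_pos|].
apply (cf_u1_bound CF); pose proof (lt01 0); lra.
Qed.

Lemma height_bound_pos : 0 < H.
Proof. pose proof (lt01 0); pose proof (cf_height CF 0); lra. Qed.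

Lemma inside_open (x y : R) : h0 x < y < h1 x ->
  locally_2d (fun x y => h0 x < y < h1 x) x y.
Proof.
apply graph_domain_open;
[apply (is_derive_continuous _ _ _ (cf_h0 CF x))
|apply (is_derive_continuous _ _ _ (cf_h1 CF x))].
Qed.

Lemma u1_cont (x y : R) : h0 x < y < h1 x -> continuity_2d_pt u1 x y.
Proof.
intros Hy; apply differentiable_continuity_pt.
eexists; eexists; now apply (cf_u1_diff CF).
Qed.

Lemma u2_cont (x y : R) : h0 x < y < h1 x -> continuity_2d_pt u2 x y.
Proof.
intros Hy; apply differentiable_continuity_pt.
eexists; eexists; now apply (cf_u2_diff CF).
Qed.

(** Composition with this projection extends [u1 x] from the closed section to a Lipschitz function
    on the line, so that continuity on the closed section can be used although [u1 x] is arbitrary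
    beyond the walls. *)
Let clamp x y := Rmax (h0 x) (Rmin (h1 x) y).

Lemma clamp_inside (x y : R) : h0 x <= clamp x y <= h1 x.
Proof.
pose proof (lt01 x); unfold clamp, Rmax, Rmin.
destruct (Rle_dec (h1 x) y); destruct Rle_dec; lra.
Qed.

Lemma clamp_id (x y : R) : h0 x <= y <= h1 x -> clamp x y = y.
Proof.
pose proof (lt01 x); intros Hy; unfold clamp, Rmax, Rmin.
destruct (Rle_dec (h1 x) y); destruct Rle_dec; lra.
Qed.

Lemma clamp_lip (x y z : R) : Rabs (clamp x y - clamp x z) <= Rabs (y - z).
Proof.
pose proof (lt01 x); unfold clamp, Rmax, Rmin.
destruct (Rle_dec (h1 x) y); destruct (Rle_dec (h1 x) z);
repeat destruct Rle_dec; unfold Rabs; repeat destruct Rcase_abs; lra.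
Qed.

Lemma ex_RInt_u1 (x y z : R) :
  h0 x <= y <= h1 x -> h0 x <= z <= h1 x -> ex_RInt (u1 x) y z.
Proof.
intros Hy Hz; apply ex_RInt_ext with (fun t => u1 x (clamp x t)).
- intros t Ht; rewrite clamp_id; [reflexivity|].
  unfold Rmin, Rmax in Ht; destruct Rle_dec; lra.
- apply (ex_RInt_continuous (V := R_CompleteNormedModule)); intros t _.
  apply continuous_of_lipschitz with M; intros r s.
  eapply Rle_trans; [apply (cf_u1_lip CF); apply clamp_inside|].
  rewrite Rminus_diag, Rabs_R0, Rplus_0_l.
  apply Rmult_le_compat_l; [apply speed_bound_nonneg | apply clamp_lip].
Qed.

Lemma psi_minus (x y z : R) : h0 x <= y <= h1 x -> h0 x <= z <= h1 x ->
  psi x z - psi x y = RInt (u1 x) y z.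
Proof.
intros Hy Hz; unfold psi.
rewrite <- (RInt_Chasles (u1 x) (h0 x) y z) by (apply ex_RInt_u1; lra).
unfold plus; simpl; ring.
Qed.

Lemma psi_bottom (x : R) : psi x (h0 x) = 0.
Proof. exact (RInt_point (V := R_CompleteNormedModule) (h0 x) (u1 x)). Qed.

Lemma abs_RInt_u1_le (x y z : R) : h0 x <= y -> y <= z -> z <= h1 x ->
  Rabs (RInt (u1 x) y z) <= (z - y) * M.
Proof.
intros Hy Hyz Hz; apply abs_RInt_le_const; [assumption | apply ex_RInt_u1; lra|].
intros t Ht; apply (cf_u1_bound CF); lra.
Qed.

Lemma psi_lt (x y z : R) : h0 x <= y -> y < z -> z <= h1 x -> psi x y < psi x z.
Proof.
intros Hy Hyz Hz; apply Rlt_0_minus; rewrite psi_minus by lra.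
replace (RInt (u1 x) y z) with (RInt (fun t => u1 x (clamp x t)) y z).
- apply RInt_gt_0; [assumption| |].
  + intros t Ht; rewrite clamp_id by lra; apply (cf_pos CF); lra.
  + intros t _; apply continuous_of_lipschitz with M; intros r s.
    eapply Rle_trans; [apply (cf_u1_lip CF); apply clamp_inside|].
    rewrite Rminus_diag, Rabs_R0, Rplus_0_l.
    apply Rmult_le_compat_l; [apply speed_bound_nonneg | apply clamp_lip].
- apply RInt_ext; intros t Ht; rewrite clamp_id; [reflexivity|].
  unfold Rmin, Rmax in Ht; destruct Rle_dec; lra.
Qed.

Lemma psi_le (x y z : R) : h0 x <= y -> y <= z -> z <= h1 x -> psi x y <= psi x z.
Proof.
intros Hy [Hyz|Hyz] Hz; [now apply Rlt_le, psi_lt | right; now rewrite Hyz].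
Qed.

Lemma is_derive_psi_2 (x y : R) : h0 x < y < h1 x ->
  is_derive (psi x) y (u1 x y).
Proof.
intros Hy; apply (is_derive_RInt (V := R_NormedModule) (u1 x) (psi x) (h0 x)).
- assert (He : 0 < Rmin (y - h0 x) (h1 x - y)) by (apply Rmin_glb_lt; lra).
  exists (mkposreal _ He); intros z Hz; change (Rabs (z - y) < Rmin (y - h0 x) (h1 x - y)) in Hz.
  pose proof (Rmin_l (y - h0 x) (h1 x - y)); pose proof (Rmin_r (y - h0 x) (h1 x - y)).
  apply Rabs_def2 in Hz.
  apply (RInt_correct (V := R_CompleteNormedModule)), ex_RInt_u1; lra.
- now apply continuity_2d_pt_continuous_2, u1_cont.
Qed.

Lemma Derive_u1_cont (x y : R) : h0 x < y < h1 x ->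
  continuity_2d_pt (fun u v => Derive (fun z => u1 z v) u) x y.
Proof.
intros Hy; apply continuity_2d_pt_ext_loc with u1x; [|now apply (cf_u1x_cont CF)].
destruct (inside_open x y Hy) as [d Hd]; exists d; intros t z Ht Hz.
symmetry; apply is_derive_unique, (differentiable_pt_lim_1 _ _ _ _ (u1y t z)).
now apply (cf_u1_diff CF), Hd.
Qed.

(** Leibniz' rule, where incompressibility turns the integral of [u1x] into boundary values of [u2].
    The curves stay strictly inside, because [u1x] need not extend continuously to the walls. *)
Lemma is_derive_flux_between (f g : R -> R) (x df dg : R) :
  is_derive f x df -> is_derive g x dg ->
  h0 x < f x -> f x <= g x -> g x < h1 x ->
  is_derive (fun t => RInt (u1 t) (f t) (g t)) x
    ((u1 x (g x) * dg - u2 x (g x)) - (u1 x (f x) * df - u2 x (f x))).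
Proof.
intros Hf Hg H0 Hfg H1.
destruct (inside_open x (f x) ltac:(lra)) as [d0 A0].
destruct (inside_open x (g x) ltac:(lra)) as [d1 A1].
pose proof (cond_pos d0); pose proof (cond_pos d1).
pose proof (Rmin_l d0 d1); pose proof (Rmin_r d0 d1).
set (d := Rmin d0 d1) in *.
assert (Hd : 0 < d) by (apply Rmin_glb_lt; lra).
assert (Hd2 : 0 < d / 2) by lra.
assert (near : forall t, Rabs (t - x) < d -> h0 t < f x - d / 2 /\ g x + d / 2 < h1 t).
{ intros t Ht.
  assert (B0 := A0 t (f x - d / 2) ltac:(lra)); assert (B1 := A1 t (g x + d / 2) ltac:(lra)).
  rewrite Rabs_left in B0 by lra; rewrite Rabs_pos_eq in B1 by lra.
  specialize (B0 ltac:(lra)); specialize (B1 ltac:(lra)); lra. }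
assert (loc : forall P : R -> Prop, (forall t, Rabs (t - x) < d -> P t) -> locally x P).
{ intros P HP; exists (mkposreal d Hd); intros t Ht; now apply HP. }
replace (_ - _) with
  (RInt (fun t => Derive (fun u => u1 u t) x) (f x) (g x)
   + - u1 x (f x) * df + u1 x (g x) * dg).
{ apply is_derive_RInt_param_bound_comp; trivial.
  - apply loc; intros t Ht; destruct (near t Ht); apply ex_RInt_u1; lra.
  - exists (mkposreal _ Hd2); apply loc; intros t Ht; simpl.
    destruct (near t Ht); apply ex_RInt_u1; lra.
  - exists (mkposreal _ Hd2); apply loc; intros t Ht; simpl.
    destruct (near t Ht); apply ex_RInt_u1; lra.
  - exists (mkposreal _ Hd2); apply loc; intros t Ht z Hz; simpl in Hz.
    rewrite Rmin_left, Rmax_right in Hz by lra; destruct (near t Ht).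
    exists (u1x t z); apply (differentiable_pt_lim_1 _ _ _ _ (u1y t z)).
    apply (cf_u1_diff CF); lra.
  - intros t Ht; rewrite Rmin_left, Rmax_right in Ht by lra.
    apply Derive_u1_cont; lra.
  - exists d0; intros t z Ht Hz; now apply Derive_u1_cont, A0.
  - exists d1; intros t z Ht Hz; now apply Derive_u1_cont, A1.
  - apply continuity_pt_filterlim, continuity_2d_pt_continuous_2, u1_cont; lra.
  - apply continuity_pt_filterlim, continuity_2d_pt_continuous_2, u1_cont; lra. }
replace (RInt _ _ _) with (- (u2 x (g x) - u2 x (f x))); [ring|].
symmetry; apply is_RInt_unique.
replace (- (u2 x (g x) - u2 x (f x))) with (minus (- u2 x (g x)) (- u2 x (f x)))
  by (unfold minus, plus, opp; simpl; ring).
apply is_RInt_ext with (fun y => - u2y x y).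
- intros y Hy; rewrite Rmin_left, Rmax_right in Hy by lra.
  rewrite (is_derive_unique _ _ (u1x x y)).
  + pose proof (cf_div CF x y ltac:(lra)); lra.
  + apply (differentiable_pt_lim_1 _ _ _ _ (u1y x y)), (cf_u1_diff CF); lra.
- apply (is_RInt_derive (V := R_CompleteNormedModule) (fun y => - u2 x y)).
  + intros y Hy; rewrite Rmin_left, Rmax_right in Hy by lra.
    apply (is_derive_opp (V := R_NormedModule) (u2 x)).
    apply (differentiable_pt_lim_2 _ _ _ (u2x x y)), (cf_u2_diff CF); lra.
  + intros y Hy; rewrite Rmin_left, Rmax_right in Hy by lra.
    apply (continuous_opp (V := R_NormedModule) (u2y x)).
    apply continuity_2d_pt_continuous_2, (cf_u2y_cont CF); lra.
Qed.

(** * Flux between level curves, up to the walls *)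

Let level th x := h0 x + th * (h1 x - h0 x).
Let dlevel th x := dh0 x + th * (dh1 x - dh0 x).
Let C := 2 * M * H * (H + 1).

Lemma is_derive_level (th x : R) : is_derive (level th) x (dlevel th x).
Proof.
apply (is_derive_plus (V := R_NormedModule) h0); [apply (cf_h0 CF)|].
apply (is_derive_scal (fun x => h1 x - h0 x)).
apply (is_derive_minus (V := R_NormedModule)); [apply (cf_h1 CF) | apply (cf_h0 CF)].
Qed.

Lemma level_inside (th x : R) : 0 < th < 1 -> h0 x < level th x < h1 x.
Proof. intros Ht; pose proof (lt01 x); unfold level; split; nra. Qed.

(** The left-hand side is the flux across the curve [level th]. On the wall it is zero by the slip
    condition; moving up by at most [th * H] changes each velocity component by at most
    [M * (th * H)] and the slope by at most [th * H]. The constant [C] collects these three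
    errors. *)
Lemma defect_bottom (th x : R) : 0 < th < 1 ->
  Rabs (u1 x (level th x) * dlevel th x - u2 x (level th x)) <= C * th.
Proof.
intros Ht; pose proof (level_inside th x Ht) as Hl; pose proof (lt01 x).
pose proof speed_bound_nonneg; pose proof height_bound_pos; pose proof (cf_height CF x).
destruct (cf_dh CF x) as [B1 [B2 _]].
assert (A1 := cf_u1_lip CF x (level th x) x (h0 x) ltac:(lra) ltac:(lra)).
assert (A2 := cf_u2_lip CF x (h0 x) x (level th x) ltac:(lra) ltac:(lra)).
assert (E : level th x - h0 x = th * (h1 x - h0 x)) by (unfold level; ring).
rewrite (Rabs_minus_sym (h0 x)) in A2.
rewrite Rminus_diag, Rabs_R0, Rplus_0_l, E in A1, A2.
rewrite (Rabs_pos_eq (th * (h1 x - h0 x))) in A1, A2 by (apply Rmult_le_pos; lra).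
assert (A3 := cf_u1_bound CF x (h0 x) ltac:(lra)).
replace (u1 x (level th x) * dlevel th x - u2 x (level th x)) with
  ((u1 x (level th x) - u1 x (h0 x)) * dlevel th x
   + u1 x (h0 x) * (th * (dh1 x - dh0 x)) + (u2 x (h0 x) - u2 x (level th x))).
2:{ rewrite (cf_slip0 CF); unfold dlevel; ring. }
assert (HM : M * (th * (h1 x - h0 x)) <= M * (th * H)).
{ apply Rmult_le_compat_l; [assumption|]; apply Rmult_le_compat_l; lra. }
assert (D1 : Rabs (dlevel th x) <= 2 * H).
{ unfold dlevel; eapply Rle_trans; [apply Rabs_triang|].
  rewrite Rabs_mult, (Rabs_pos_eq th) by lra.
  assert (th * Rabs (dh1 x - dh0 x) <= 1 * H)
    by (apply Rmult_le_compat; try apply Rabs_pos; lra).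
  lra. }
eapply Rle_trans; [apply Rabs_triang|].
replace (C * th) with (M * (th * H) * (2 * H) + M * (th * H) + M * (th * H))
  by (unfold C; ring).
apply Rplus_le_compat; [|lra].
eapply Rle_trans; [apply Rabs_triang|]; apply Rplus_le_compat; rewrite Rabs_mult.
- apply Rmult_le_compat; try apply Rabs_pos; lra.
- apply Rmult_le_compat; try apply Rabs_pos; [lra|].
  rewrite Rabs_mult, (Rabs_pos_eq th) by lra; apply Rmult_le_compat_l; lra.
Qed.

Lemma defect_top (th x : R) : 0 < th < 1 ->
  Rabs (u1 x (level (1 - th) x) * dlevel (1 - th) x - u2 x (level (1 - th) x))
    <= C * th.
Proof.
intros Ht; pose proof (level_inside (1 - th) x ltac:(lra)) as Hl; pose proof (lt01 x).
pose proof speed_bound_nonneg; pose proof height_bound_pos; pose proof (cf_height CF x).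
destruct (cf_dh CF x) as [B1 [_ B2]].
set (y := level (1 - th) x) in *.
assert (A1 := cf_u1_lip CF x y x (h1 x) ltac:(lra) ltac:(lra)).
assert (A2 := cf_u2_lip CF x (h1 x) x y ltac:(lra) ltac:(lra)).
assert (E : h1 x - y = th * (h1 x - h0 x)) by (unfold y, level; ring).
rewrite (Rabs_minus_sym y) in A1.
rewrite Rminus_diag, Rabs_R0, Rplus_0_l, E in A1, A2.
rewrite (Rabs_pos_eq (th * (h1 x - h0 x))) in A1, A2 by (apply Rmult_le_pos; lra).
assert (A3 := cf_u1_bound CF x (h1 x) ltac:(lra)).
replace (u1 x y * dlevel (1 - th) x - u2 x y) with
  ((u1 x y - u1 x (h1 x)) * dlevel (1 - th) x
   + - (u1 x (h1 x) * (th * (dh1 x - dh0 x))) + (u2 x (h1 x) - u2 x y)).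
2:{ rewrite (cf_slip1 CF); unfold dlevel; ring. }
assert (HM : M * (th * (h1 x - h0 x)) <= M * (th * H)).
{ apply Rmult_le_compat_l; [assumption|]; apply Rmult_le_compat_l; lra. }
assert (D1 : Rabs (dlevel (1 - th) x) <= 2 * H).
{ replace (dlevel (1 - th) x) with (dh1 x + - (th * (dh1 x - dh0 x)))
    by (unfold dlevel; ring).
  eapply Rle_trans; [apply Rabs_triang|].
  rewrite Rabs_Ropp, Rabs_mult, (Rabs_pos_eq th) by lra.
  assert (th * Rabs (dh1 x - dh0 x) <= 1 * H)
    by (apply Rmult_le_compat; try apply Rabs_pos; lra).
  lra. }
eapply Rle_trans; [apply Rabs_triang|].
replace (C * th) with (M * (th * H) * (2 * H) + M * (th * H) + M * (th * H))
  by (unfold C; ring).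
apply Rplus_le_compat; [|lra].
eapply Rle_trans; [apply Rabs_triang|]; apply Rplus_le_compat; rewrite ?Rabs_Ropp, Rabs_mult.
- apply Rmult_le_compat; try apply Rabs_pos; lra.
- apply Rmult_le_compat; try apply Rabs_pos; [lra|].
  rewrite Rabs_mult, (Rabs_pos_eq th) by lra; apply Rmult_le_compat_l; lra.
Qed.

Lemma defect_bound_nonneg : 0 <= C.
Proof.
pose proof speed_bound_nonneg; pose proof height_bound_pos; unfold C.
repeat apply Rmult_le_pos; lra.
Qed.

(** The flux between the levels [th] and [1 - th] has a slope of at most [2 * C * th], since each
    curve lets through at most [C * th], and it misses the total flux by at most [2 * (M * H) * th].
    All errors vanish with [th]. *)
Lemma psi_top_const (x x' : R) : psi x' (h1 x') = psi x (h1 x).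
Proof.
pose proof speed_bound_nonneg; pose proof height_bound_pos; pose proof defect_bound_nonneg.
pose proof (Rabs_pos (x' - x)).
enough (A : Rabs (psi x' (h1 x') - psi x (h1 x)) <= 0).
{ apply Rminus_diag_uniq.
  destruct (Req_dec (psi x' (h1 x') - psi x (h1 x)) 0) as [E|E]; [exact E|].
  apply Rabs_pos_lt in E; lra. }
apply le_of_le_add_small with (2 * C * Rabs (x' - x) + 4 * (M * H)).
2:{ assert (0 <= M * H) by (apply Rmult_le_pos; lra).
    assert (0 <= C * Rabs (x' - x)) by (apply Rmult_le_pos; lra); lra. }
intros th Ht.
pose (F := fun t => RInt (u1 t) (level th t) (level (1 - th) t)).
assert (FE : forall t, Rabs (psi t (h1 t) - F t) <= 2 * (M * H) * th).
{ intros t; pose proof (lt01 t); pose proof (cf_height CF t).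
  pose proof (level_inside th t ltac:(lra)); pose proof (level_inside (1 - th) t ltac:(lra)).
  assert (E1 : level th t - h0 t = th * (h1 t - h0 t)) by (unfold level; ring).
  assert (E2 : h1 t - level (1 - th) t = th * (h1 t - h0 t)) by (unfold level; ring).
  assert (level th t <= level (1 - th) t) by (unfold level; nra).
  unfold F; rewrite <- psi_minus by lra.
  replace (_ - _) with ((psi t (h1 t) - psi t (level (1 - th) t))
    + (psi t (level th t) - psi t (h0 t))) by (rewrite psi_bottom; ring).
  rewrite 2!psi_minus by lra.
  eapply Rle_trans; [apply Rabs_triang|].
  eapply Rle_trans; [apply Rplus_le_compat; apply abs_RInt_u1_le; lra|].
  rewrite E1, E2; assert (th * (h1 t - h0 t) * M <= th * H * M).
  { apply Rmult_le_compat_r; [lra|]; apply Rmult_le_compat_l; lra. }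
  lra. }
assert (A : Rabs (F x' - F x) <= 2 * C * th * Rabs (x' - x)).
{ apply (increment_abs_le F (fun t =>
    (u1 t (level (1 - th) t) * dlevel (1 - th) t - u2 t (level (1 - th) t))
    - (u1 t (level th t) * dlevel th t - u2 t (level th t)))).
  - intros t _; pose proof (lt01 t).
    apply is_derive_flux_between; try apply is_derive_level; unfold level; nra.
  - intros t _; eapply Rle_trans; [apply Rabs_triang|]; rewrite Rabs_Ropp.
    pose proof (defect_top th t ltac:(lra)); pose proof (defect_bottom th t ltac:(lra)); lra. }
replace (psi x' (h1 x') - psi x (h1 x)) with
  ((psi x' (h1 x') - F x') + (F x' - F x) - (psi x (h1 x) - F x)) by ring.
eapply Rle_trans; [apply Rabs_triang|]; rewrite Rabs_Ropp.
assert (A' := Rabs_triang (psi x' (h1 x') - F x') (F x' - F x)).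
pose proof (FE x); pose proof (FE x'); lra.
Qed.

Lemma is_derive_psi_1 (x y : R) : h0 x < y < h1 x ->
  is_derive (fun t => psi t y) x (- u2 x y).
Proof.
intros Hy; apply is_derive_of_little_o; intros eps He.
pose proof speed_bound_nonneg; pose proof height_bound_pos; pose proof defect_bound_nonneg.
destruct (inside_open x y Hy) as [d Hd].
pose proof (cond_pos d) as d_pos.
assert (Hc := continuity_2d_pt_continuous_1 u2 x y (u2_cont x y Hy)).
destruct (continuous_eps _ x eps Hc He) as [d' [Hd' A']].
exists (Rmin d d'); split; [now apply Rmin_glb_lt|]; intros t Ht.
pose proof (Rmin_l d d'); pose proof (Rmin_r d d').
pose proof (Rabs_pos (t - x)).
assert (ins : forall r, Rmin x t <= r <= Rmax x t ->
  h0 r < y < h1 r /\ Rabs (u2 r y - u2 x y) < eps).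
{ intros r Hr.
  assert (Rabs (r - x) <= Rabs (t - x)).
  { unfold Rmin, Rmax in Hr; unfold Rabs; destruct Rle_dec; repeat destruct Rcase_abs; lra. }
  split; [apply Hd; [lra|]; rewrite Rminus_diag, Rabs_R0; lra | apply A'; lra]. }
(* One [th0] serves all sections between [x] and [t], because [y - h0 r] attains a positive minimum
   there. *)
assert (exists th0, 0 < th0 <= 1 / 2 /\ forall r th, Rmin x t <= r <= Rmax x t ->
  0 < th < th0 -> level th r < y) as [th0 [Hth0 below]].
{ destruct (continuity_ab_min (fun r => y - h0 r) (Rmin x t) (Rmax x t)) as [r0 [Hm Hr0]].
  - apply Rminmax.
  - intros r _; apply continuity_pt_filterlim.
    apply (continuous_minus (V := R_NormedModule)); [apply continuous_const|].
    apply (is_derive_continuous _ _ _ (cf_h0 CF r)).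
  - destruct (ins r0 Hr0) as [B _].
    exists (Rmin (1 / 2) ((y - h0 r0) / H)).
    pose proof (Rmin_l (1 / 2) ((y - h0 r0) / H)).
    pose proof (Rmin_r (1 / 2) ((y - h0 r0) / H)).
    split; [split; [apply Rmin_glb_lt; [lra | apply Rdiv_lt_0_compat; lra] | assumption]|].
    intros r th Hr Hth; specialize (Hm r Hr); simpl in Hm.
    pose proof (cf_height CF r); pose proof (lt01 r).
    assert (th * H < y - h0 r0).
    { apply Rlt_le_trans with ((y - h0 r0) / H * H);
      [apply Rmult_lt_compat_r; lra | right; field; lra]. }
    unfold level; nra. }
(* The factor [th0 * 2] rescales the range [(0, 1 / 2)] of the limit lemma to [(0, th0)]. *)
apply le_of_le_add_small with (th0 * 2 * (C * Rabs (t - x) + 2 * (M * H))).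
2:{ assert (0 <= M * H) by (apply Rmult_le_pos; lra).
    assert (0 <= C * Rabs (t - x)) by (apply Rmult_le_pos; lra); nra. }
intros th' Hth'.
set (th := th0 * 2 * th').
assert (Hth : 0 < th < th0) by (unfold th; nra).
replace (th0 * 2 * (C * Rabs (t - x) + 2 * (M * H)) * th')
  with ((C * Rabs (t - x) + 2 * (M * H)) * th) by (unfold th; ring).
pose (F := fun t => RInt (u1 t) (level th t) y).
assert (FE : forall r, Rmin x t <= r <= Rmax x t -> Rabs (psi r y - F r) <= (M * H) * th).
{ intros r Hr; pose proof (lt01 r); pose proof (cf_height CF r).
  pose proof (level_inside th r ltac:(lra)); pose proof (below r th Hr Hth).
  destruct (ins r Hr) as [B _].
  assert (E1 : level th r - h0 r = th * (h1 r - h0 r)) by (unfold level; ring).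
  unfold F; rewrite <- psi_minus by lra.
  replace (_ - _) with (psi r (level th r) - psi r (h0 r)) by (rewrite psi_bottom; ring).
  rewrite psi_minus by lra.
  eapply Rle_trans; [apply abs_RInt_u1_le; lra|].
  rewrite E1; assert (th * (h1 r - h0 r) * M <= th * H * M).
  { apply Rmult_le_compat_r; [lra|]; apply Rmult_le_compat_l; lra. }
  lra. }
assert (A : Rabs ((F t + u2 x y * t) - (F x + u2 x y * x)) <= (eps + C * th) * Rabs (t - x)).
{ apply (increment_abs_le (fun r => F r + u2 x y * r) (fun r =>
    ((u1 r y * 0 - u2 r y) - (u1 r (level th r) * dlevel th r - u2 r (level th r)))
    + u2 x y)).
  - intros r Hr; destruct (ins r Hr) as [B _]; pose proof (below r th Hr Hth).
    pose proof (level_inside th r ltac:(lra)).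
    apply (is_derive_plus (V := R_NormedModule) F).
    + apply (is_derive_flux_between (level th) (fun _ => y)); try lra.
      * apply is_derive_level.
      * apply (is_derive_const (V := R_NormedModule)).
    + replace (u2 x y) with (u2 x y * 1) at 2 by ring.
      apply (is_derive_scal (fun r => r)), (is_derive_id (K := R_AbsRing)).
  - intros r Hr; destruct (ins r Hr) as [_ B].
    pose proof (defect_bottom th r ltac:(lra)) as E.
    apply Rabs_def2 in B; apply Rabs_le_between in E; apply Rabs_le; lra. }
replace (psi t y - psi x y - - u2 x y * (t - x)) with
  ((psi t y - F t) + ((F t + u2 x y * t) - (F x + u2 x y * x)) - (psi x y - F x)) by ring.
eapply Rle_trans; [apply Rabs_triang|]; rewrite Rabs_Ropp.
pose proof (Rabs_triang (psi t y - F t) (F t + u2 x y * t - (F x + u2 x y * x))).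
pose proof (FE t (conj (Rmin_r _ _) (Rmax_r _ _))).
pose proof (FE x (conj (Rmin_l _ _) (Rmax_l _ _))); lra.
Qed.

Lemma psi_upstream (eps : R) : 0 < eps -> exists N, N <= Lm /\
  forall x y, x < N -> 0 <= y <= 1 -> Rabs (psi x y - poiseuille_flux Q y) <= eps.
Proof.
intros He; destruct (cf_upstream CF eps He) as [N HN].
exists (Rmin N Lm); split; [apply Rmin_r|]; intros x y Hx Hy.
pose proof (Rmin_l N Lm); pose proof (Rmin_r N Lm).
destruct (cf_inlet CF x ltac:(lra)) as [E0 E1].
assert (I : is_RInt (fun t => 6 * Q * t * (1 - t)) 0 y (poiseuille_flux Q y)).
{ replace (poiseuille_flux Q y) with (minus (poiseuille_flux Q y) (poiseuille_flux Q 0))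
    by (unfold minus, plus, opp, poiseuille_flux; simpl; ring).
  apply (is_RInt_derive (V := R_CompleteNormedModule) (poiseuille_flux Q)).
  - intros t _; unfold poiseuille_flux; auto_derive; [trivial | ring].
  - intros t _; apply (is_derive_continuous _ t (6 * Q * (1 - t) - 6 * Q * t)).
    auto_derive; [trivial | ring]. }
rewrite <- (is_RInt_unique _ _ _ _ I); unfold psi; rewrite E0.
assert (J : ex_RInt (u1 x) 0 y) by (apply ex_RInt_u1; lra).
assert (I' : ex_RInt (fun t => 6 * Q * t * (1 - t)) 0 y) by (eexists; exact I).
replace (_ - _) with (RInt (fun t => minus (u1 x t) (6 * Q * t * (1 - t))) 0 y)
  by exact (RInt_minus (V := R_CompleteNormedModule) _ _ _ _ J I').
apply Rle_trans with ((y - 0) * eps); [|nra].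
apply abs_RInt_le_const; [lra | now apply (ex_RInt_minus (V := R_NormedModule))|].
intros t Ht; apply Rlt_le, (HN x t); lra.
Qed.

(** The total flux is constant in [x] and comes arbitrarily close to [poiseuille_flux Q 1 = Q]
    upstream. *)
Lemma psi_top (x : R) : psi x (h1 x) = Q.
Proof.
apply Rminus_diag_uniq.
destruct (Req_dec (psi x (h1 x) - Q) 0) as [E|E]; [exact E|exfalso].
apply Rabs_pos_lt in E.
destruct (psi_upstream (Rabs (psi x (h1 x) - Q) / 2)) as [N [HN A]]; [lra|].
specialize (A (N - 1) 1 ltac:(lra) ltac:(lra)).
destruct (cf_inlet CF (N - 1) ltac:(lra)) as [_ E1].
pose proof (psi_top_const x (N - 1)) as T; rewrite E1 in T; rewrite T in A.
replace (poiseuille_flux Q 1) with Q in A by (unfold poiseuille_flux; ring); lra.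
Qed.

Lemma psi_diff (x y : R) : h0 x < y < h1 x ->
  differentiable_pt_lim psi x y (- u2 x y) (u1 x y).
Proof.
intros Hy; apply (differentiable_pt_lim_of_partials psi (fun x y => - u2 x y)).
- destruct (inside_open x y Hy) as [d Hd]; exists d; intros t z Ht Hz.
  now apply is_derive_psi_1, Hd.
- now apply is_derive_psi_2.
- now apply continuity_2d_pt_opp, u2_cont.
Qed.

Lemma psi_lip (x y z : R) : h0 x <= y <= h1 x -> h0 x <= z <= h1 x ->
  Rabs (psi x y - psi x z) <= M * Rabs (y - z).
Proof.
intros Hy Hz; destruct (Rle_or_lt y z) as [Hyz|Hyz].
- rewrite Rabs_minus_sym, (Rabs_minus_sym y), psi_minus, (Rabs_pos_eq (z - y)) by lra.
  rewrite Rmult_comm; apply abs_RInt_u1_le; lra.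
- rewrite psi_minus, (Rabs_pos_eq (y - z)) by lra.
  rewrite Rmult_comm; apply abs_RInt_u1_le; lra.
Qed.

(** * Heights of the streamlines *)

Let Y x s := epsilon (inhabits 0) (fun y => h0 x < y < h1 x /\ psi x y = s).

Lemma Y_spec (x s : R) : 0 < s < Q -> h0 x < Y x s < h1 x /\ psi x (Y x s) = s.
Proof.
intros Hs; apply (epsilon_spec (inhabits 0) (fun y => h0 x < y < h1 x /\ psi x y = s)).
pose proof (lt01 x); pose proof (psi_top x) as T1; pose proof (psi_bottom x) as T0.
destruct (IVT_gen_consistent (fun y => psi x (clamp x y)) (h0 x) (h1 x) s) as [y [Hy E]].
- intros y; apply continuous_of_lipschitz with M; intros r t.
  eapply Rle_trans; [apply psi_lip; apply clamp_inside|].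
  apply Rmult_le_compat_l; [apply speed_bound_nonneg | apply clamp_lip].
- rewrite 2!clamp_id, T0, T1, Rmin_left, Rmax_right by lra; lra.
- rewrite Rmin_left, Rmax_right in Hy by lra; rewrite clamp_id in E by lra.
  exists y; split; [|assumption]; split; apply Rnot_le_lt; intros Hle.
  + replace y with (h0 x) in E by lra; lra.
  + replace y with (h1 x) in E by lra; lra.
Qed.

Lemma Y_unique (x y : R) : h0 x < y < h1 x -> 0 < psi x y < Q /\ Y x (psi x y) = y.
Proof.
intros Hy.
assert (Hs : 0 < psi x y < Q).
{ rewrite <- (psi_bottom x) at 1; rewrite <- (psi_top x).
  split; apply psi_lt; lra. }
split; [assumption|]; destruct (Y_spec x _ Hs) as [A E].
destruct (Rtotal_order (Y x (psi x y)) y) as [L|[L|L]]; [exfalso|exact L|exfalso].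
- apply (psi_lt x) in L; lra.
- apply (psi_lt x) in L; lra.
Qed.

Lemma Y_gt (x y s : R) : 0 < s < Q -> h0 x <= y <= h1 x -> psi x y < s -> y < Y x s.
Proof.
intros Hs Hy L; destruct (Y_spec x s Hs) as [A E].
apply Rnot_le_lt; intros Hle; apply (psi_le x) in Hle; lra.
Qed.

Lemma Y_lt (x y s : R) : 0 < s < Q -> h0 x <= y <= h1 x -> s < psi x y -> Y x s < y.
Proof.
intros Hs Hy L; destruct (Y_spec x s Hs) as [A E].
apply Rnot_le_lt; intros Hle; apply (psi_le x) in Hle; lra.
Qed.

(** Since [psi] is strictly increasing in [y], the strict inequalities
    [psi x (y - e) < s < psi x (y + e)] trap the streamline. They persist under small changes of [x]
    and [s], so continuity of [psi] in [x] at two fixed heights is enough. *)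
Lemma Y_cont (x s : R) : 0 < s < Q -> continuity_2d_pt Y x s.
Proof.
intros Hs eps; destruct (Y_spec x s Hs) as [A E]; set (y := Y x s) in *.
pose proof (cond_pos eps).
assert (He : 0 < Rmin eps (Rmin (y - h0 x) (h1 x - y)))
  by (repeat apply Rmin_glb_lt; lra).
set (e := Rmin eps (Rmin (y - h0 x) (h1 x - y)) / 2).
assert (e < eps /\ e < y - h0 x /\ e < h1 x - y) as [E1 [E2 E3]].
{ unfold e; pose proof (Rmin_l eps (Rmin (y - h0 x) (h1 x - y))).
  pose proof (Rmin_r eps (Rmin (y - h0 x) (h1 x - y))).
  pose proof (Rmin_l (y - h0 x) (h1 x - y)); pose proof (Rmin_r (y - h0 x) (h1 x - y)); lra. }
assert (e_pos : 0 < e) by (unfold e; lra).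
assert (L1 : psi x (y - e) < s) by (rewrite <- E; apply psi_lt; lra).
assert (L2 : s < psi x (y + e)) by (rewrite <- E at 1; apply psi_lt; lra).
destruct (inside_open x (y - e) ltac:(lra)) as [d1 D1].
destruct (inside_open x (y + e) ltac:(lra)) as [d2 D2].
assert (c1 := is_derive_continuous _ _ _ (is_derive_psi_1 x (y - e) ltac:(lra))).
assert (c2 := is_derive_continuous _ _ _ (is_derive_psi_1 x (y + e) ltac:(lra))).
destruct (continuous_eps _ _ ((s - psi x (y - e)) / 2) c1 ltac:(lra)) as [d3 [Hd3 D3]].
destruct (continuous_eps _ _ ((psi x (y + e) - s) / 2) c2 ltac:(lra)) as [d4 [Hd4 D4]].
set (r := Rmin (Rmin (s - psi x (y - e)) (psi x (y + e) - s)) (Rmin s (Q - s))).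
assert (Hr : 0 < r) by (repeat apply Rmin_glb_lt; lra).
assert (r <= s - psi x (y - e) /\ r <= psi x (y + e) - s /\ r <= s /\ r <= Q - s)
  as [R1 [R2 [R3 R4]]].
{ pose proof (Rmin_l (Rmin (s - psi x (y - e)) (psi x (y + e) - s)) (Rmin s (Q - s))).
  pose proof (Rmin_r (Rmin (s - psi x (y - e)) (psi x (y + e) - s)) (Rmin s (Q - s))).
  pose proof (Rmin_l (s - psi x (y - e)) (psi x (y + e) - s)).
  pose proof (Rmin_r (s - psi x (y - e)) (psi x (y + e) - s)).
  pose proof (Rmin_l s (Q - s)); pose proof (Rmin_r s (Q - s)); unfold r; lra. }
(* Half of each gap between [s] and the two values of [psi] is spent on moving [x], the other half
   on moving [s]. *)
set (d := Rmin (Rmin (Rmin d1 d2) (Rmin d3 d4)) (r / 2)).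
pose proof (cond_pos d1); pose proof (cond_pos d2).
assert (Hd : 0 < d) by (repeat apply Rmin_glb_lt; lra).
assert (d <= d1 /\ d <= d2 /\ d <= d3 /\ d <= d4 /\ d <= r / 2)
  as [K1 [K2 [K3 [K4 K5]]]].
{ pose proof (Rmin_l (Rmin (Rmin d1 d2) (Rmin d3 d4)) (r / 2)).
  pose proof (Rmin_r (Rmin (Rmin d1 d2) (Rmin d3 d4)) (r / 2)).
  pose proof (Rmin_l (Rmin d1 d2) (Rmin d3 d4)); pose proof (Rmin_r (Rmin d1 d2) (Rmin d3 d4)).
  pose proof (Rmin_l d1 d2); pose proof (Rmin_r d1 d2).
  pose proof (Rmin_l d3 d4); pose proof (Rmin_r d3 d4); unfold d; lra. }
exists (mkposreal d Hd); simpl; intros t z Ht Hz.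
assert (B1 := D1 t (y - e) ltac:(lra)); assert (B2 := D2 t (y + e) ltac:(lra)).
rewrite Rminus_diag, Rabs_R0 in B1, B2.
specialize (B1 (cond_pos d1)); specialize (B2 (cond_pos d2)).
assert (B3 := D3 t ltac:(lra)); assert (B4 := D4 t ltac:(lra)).
apply Rabs_def2 in B3; apply Rabs_def2 in B4; apply Rabs_def2 in Hz.
assert (G1 : y - e < Y t z) by (apply Y_gt; lra).
assert (G2 : Y t z < y + e) by (apply Y_lt; lra).
apply Rabs_def1; lra.
Qed.

Lemma is_derive_Y_1 (x s : R) : 0 < s < Q ->
  is_derive (fun t => Y t s) x (u2 x (Y x s) / u1 x (Y x s)).
Proof.
intros Hs; destruct (Y_spec x s Hs) as [A E]; pose proof (cf_pos CF _ _ A).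
replace (u2 x (Y x s) / u1 x (Y x s)) with ((0 - - u2 x (Y x s)) / u1 x (Y x s))
  by (field; lra).
apply (is_derive_implicit psi); [now apply psi_diff | lra | |].
- now apply (continuity_2d_pt_continuous_1 Y), Y_cont.
- apply filter_forall; refine (fun t : R => _); rewrite 2!(proj2 (Y_spec _ s Hs)); ring.
Qed.

Lemma is_derive_Y_2 (x s : R) : 0 < s < Q ->
  is_derive (fun t => Y x t) s (/ u1 x (Y x s)).
Proof.
intros Hs; destruct (Y_spec x s Hs) as [A E]; pose proof (cf_pos CF _ _ A).
replace (/ u1 x (Y x s)) with ((1 - 0) / u1 x (Y x s)) by (field; lra).
apply (is_derive_implicit (fun _ y => psi x y)); [| lra | |].
- apply (differentiable_pt_lim_of_partials (fun _ y => psi x y) (fun _ _ => 0)).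
  + exists (mkposreal 1 Rlt_0_1); intros; apply (is_derive_const (V := R_NormedModule)).
  + now apply is_derive_psi_2.
  + apply continuity_2d_pt_const.
- now apply (continuity_2d_pt_continuous_2 Y), Y_cont.
- assert (He : 0 < Rmin s (Q - s)) by (apply Rmin_glb_lt; lra).
  exists (mkposreal _ He); refine (fun (t : R) Ht => _).
  change (Rabs (t - s) < Rmin s (Q - s)) in Ht.
  pose proof (Rmin_l s (Q - s)); pose proof (Rmin_r s (Q - s)); apply Rabs_def2 in Ht.
  rewrite E, (proj2 (Y_spec x t ltac:(lra))); ring.
Qed.

Lemma flux_pos : 0 < Q.
Proof.
pose proof (lt01 0).
assert (A := psi_lt 0 (h0 0) (h1 0) ltac:(lra) ltac:(lra) ltac:(lra)).
now rewrite psi_top, psi_bottom in A.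
Qed.

Lemma psi_level_cont (th x : R) : 0 < th < 1 ->
  continuity_pt (fun t => psi t (level th t)) x.
Proof.
intros Ht; apply continuity_pt_filterlim.
apply (is_derive_continuous (fun t => psi t (level th t)) x
  (- u2 x (level th x) + u1 x (level th x) * dlevel th x)).
apply (differentiable_pt_lim_comp_curve psi (level th)); [|apply is_derive_level].
now apply psi_diff, level_inside.
Qed.

(** The flux below the curve [level th] has a positive minimum over the compact range of [x]. A
    streamline of smaller flux runs under that curve, hence within [th * H <= eps] of the lower
    wall; the upper wall is treated symmetrically. *)
Lemma Y_near_walls (T eps : R) : 0 < eps -> exists d0, 0 < d0 /\
  forall d x, 0 < d < d0 -> d < Q -> Rabs x <= T ->
    Y x d - h0 x <= eps /\ h1 x - Y x (Q - d) <= eps.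
Proof.
intros He; pose proof height_bound_pos as HH; pose proof (Rabs_pos T).
assert (Hq : 0 < eps / H) by now apply Rdiv_lt_0_compat.
set (th := Rmin (1 / 2) (eps / H)).
assert (Ht : 0 < th) by (apply Rmin_glb_lt; lra).
assert (Ht1 : th <= 1 / 2) by apply Rmin_l.
assert (HtH : th * H <= eps).
{ apply Rle_trans with (eps / H * H);
  [apply Rmult_le_compat_r; [lra | apply Rmin_r] | right; field; lra]. }
assert (bd : forall t, th * (h1 t - h0 t) <= eps).
{ intros t; pose proof (cf_height CF t).
  apply Rle_trans with (2 := HtH); apply Rmult_le_compat_l; lra. }
(* With [Rabs T] the interval is nonempty also for negative [T]. *)
destruct (continuity_ab_min (fun t => psi t (level th t)) (- Rabs T) (Rabs T))
  as [t1 [M1 _]]; [lra | intros; apply psi_level_cont; lra|].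
destruct (continuity_ab_maj (fun t => psi t (level (1 - th) t)) (- Rabs T) (Rabs T))
  as [t2 [M2 _]]; [lra | intros; apply psi_level_cont; lra|].
pose proof (level_inside th t1 ltac:(lra)); pose proof (level_inside (1 - th) t2 ltac:(lra)).
exists (Rmin (psi t1 (level th t1)) (Q - psi t2 (level (1 - th) t2))); split.
- apply Rmin_glb_lt.
  + rewrite <- (psi_bottom t1); apply psi_lt; lra.
  + apply Rlt_0_minus; rewrite <- (psi_top t2); apply psi_lt; lra.
- intros d x Hd HdQ Hx; pose proof (bd x).
  pose proof (Rmin_l (psi t1 (level th t1)) (Q - psi t2 (level (1 - th) t2))).
  pose proof (Rmin_r (psi t1 (level th t1)) (Q - psi t2 (level (1 - th) t2))).
  pose proof (level_inside th x ltac:(lra)); pose proof (level_inside (1 - th) x ltac:(lra)).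
  assert (Hx' : - Rabs T <= x <= Rabs T).
  { apply Rabs_le_between; apply Rle_trans with (1 := Hx), Rle_abs. }
  specialize (M1 x Hx'); specialize (M2 x Hx'); simpl in M1, M2.
  assert (Y x d < level th x) by (apply Y_lt; lra).
  assert (level (1 - th) x < Y x (Q - d)) by (apply Y_gt; lra).
  unfold level in *; lra.
Qed.

(** * Upstream limits along a streamline *)

Lemma Y_upstream (s eps : R) : 0 < s < Q -> 0 < eps -> exists N, N <= Lm /\
  forall x, x < N -> Rabs (Y x s - poiseuille_height Q s) < eps.
Proof.
intros Hs He; destruct (poiseuille_height_spec Q s Hs) as [Hy E].
set (y := poiseuille_height Q s) in *.
assert (He' : 0 < Rmin eps (Rmin y (1 - y))) by (repeat apply Rmin_glb_lt; lra).
set (e := Rmin eps (Rmin y (1 - y)) / 2).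
assert (e < eps /\ e < y /\ e < 1 - y) as [E1 [E2 E3]].
{ unfold e; pose proof (Rmin_l eps (Rmin y (1 - y))).
  pose proof (Rmin_r eps (Rmin y (1 - y))).
  pose proof (Rmin_l y (1 - y)); pose proof (Rmin_r y (1 - y)); lra. }
assert (e_pos : 0 < e) by (unfold e; lra).
assert (L1 : poiseuille_flux Q (y - e) < s)
  by (rewrite <- E; apply poiseuille_flux_lt; lra).
assert (L2 : s < poiseuille_flux Q (y + e))
  by (rewrite <- E at 1; apply poiseuille_flux_lt; lra).
destruct (psi_upstream (Rmin (s - poiseuille_flux Q (y - e)) (poiseuille_flux Q (y + e) - s) / 2))
  as [N [HN A]].
{ apply Rdiv_lt_0_compat; [apply Rmin_glb_lt|]; lra. }
exists N; split; [assumption|]; intros x Hx.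
destruct (cf_inlet CF x ltac:(lra)) as [Z0 Z1].
assert (B1 := A x (y - e) Hx ltac:(lra)); assert (B2 := A x (y + e) Hx ltac:(lra)).
pose proof (Rmin_l (s - poiseuille_flux Q (y - e)) (poiseuille_flux Q (y + e) - s)).
pose proof (Rmin_r (s - poiseuille_flux Q (y - e)) (poiseuille_flux Q (y + e) - s)).
apply Rabs_le_between in B1; apply Rabs_le_between in B2.
assert (y - e < Y x s) by (apply Y_gt; lra).
assert (Y x s < y + e) by (apply Y_lt; lra).
apply Rabs_def1; lra.
Qed.

Lemma u1_upstream (s : R) : 0 < s < Q ->
  is_lim (fun x => u1 x (Y x s)) m_infty (poiseuille_speed Q s).
Proof.
intros Hs; apply is_lim_spec; intros eps; pose proof flux_pos.
destruct (poiseuille_height_spec Q s Hs) as [Hy _].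
unfold poiseuille_speed; set (y := poiseuille_height Q s) in *.
pose proof (cond_pos eps).
(* The profile has Lipschitz constant [6 * Q] on [[0, 1]], so this accuracy in height costs
   [eps / 2]; the other half is the uniform convergence of [u1], which is evaluated at a moving
   height. *)
destruct (Y_upstream s (eps / (12 * Q)) Hs) as [N1 [HN1 A1]];
  [apply Rdiv_lt_0_compat; lra|].
destruct (cf_upstream CF (eps / 2)) as [N2 A2]; [lra|].
exists (Rmin N1 N2); intros x Hx.
pose proof (Rmin_l N1 N2); pose proof (Rmin_r N1 N2).
destruct (cf_inlet CF x ltac:(lra)) as [Z0 Z1].
destruct (Y_spec x s Hs) as [B _].
assert (C1 := A1 x ltac:(lra)); assert (C2 := A2 x (Y x s) ltac:(lra) ltac:(lra)).
fold y in C1; set (z := Y x s) in *.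
replace (u1 x z - 6 * Q * y * (1 - y)) with
  ((u1 x z - 6 * Q * z * (1 - z)) + 6 * Q * ((z - y) * (1 - z - y))) by ring.
eapply Rle_lt_trans; [apply Rabs_triang|].
rewrite Rabs_mult, (Rabs_pos_eq (6 * Q)), Rabs_mult by lra.
assert (Rabs (1 - z - y) <= 1) by (apply Rabs_le; lra).
assert (Rabs (z - y) * Rabs (1 - z - y) <= eps / (12 * Q) * 1).
{ apply Rmult_le_compat; try apply Rabs_pos; lra. }
assert (6 * Q * (Rabs (z - y) * Rabs (1 - z - y)) <= eps / 2).
{ apply Rle_trans with (6 * Q * (eps / (12 * Q) * 1));
  [apply Rmult_le_compat_l; lra | right; field; lra]. }
lra.
Qed.

(* Barbalat's argument: [Y(., s)] converges upstream and its slope is [u2 / u1], so [u2] is small somewhere in every short interval, hence everywhere since it is Lipschitz. *)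
Lemma u2_upstream (s : R) : 0 < s < Q ->
  is_lim (fun x => u2 x (Y x s)) m_infty 0.
Proof.
intros Hs; apply is_lim_spec; intros eps; pose proof (cond_pos eps).
pose proof speed_bound_nonneg as HM.
set (r := Rmin 1 (eps / (6 * (M + 1)))).
assert (Hr : 0 < r) by (apply Rmin_glb_lt; [lra|]; apply Rdiv_lt_0_compat; lra).
assert (Hr1 : r <= 1) by apply Rmin_l.
assert (Hr2 : 6 * (M + 1) * r <= eps).
{ apply Rle_trans with (6 * (M + 1) * (eps / (6 * (M + 1))));
  [apply Rmult_le_compat_l; [lra | apply Rmin_r] | right; field; lra]. }
(* An accuracy of [r * r] over a step of length [r] makes the mean slope at most [2 * r], hence [u2]
   at most [2 * M * r] at some point [c]; passing from [c] to [x] costs at most [3 * M * r] more. *)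
destruct (Y_upstream s (r * r) Hs) as [N [HN A]]; [nra|].
exists N; intros x Hx; rewrite Rminus_0_r.
destruct (MVT_gen (fun t => Y t s) (x - r) x (fun t => u2 t (Y t s) / u1 t (Y t s)))
  as [c [Hc E]].
{ intros; now apply is_derive_Y_1. }
{ intros t _; apply continuity_pt_filterlim.
  now apply (continuity_2d_pt_continuous_1 Y), Y_cont. }
rewrite Rmin_left, Rmax_right in Hc by lra.
destruct (Y_spec x s Hs) as [Bx _]; destruct (Y_spec c s Hs) as [Bc _].
assert (D1 := A x ltac:(lra)); assert (D2 := A (x - r) ltac:(lra)).
assert (D3 := A c ltac:(lra)).
apply Rabs_def2 in D1; apply Rabs_def2 in D2; apply Rabs_def2 in D3.
pose proof (cf_pos CF c _ Bc) as Pc.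
assert (Mc := cf_u1_bound CF c (Y c s) ltac:(lra)); rewrite Rabs_pos_eq in Mc by lra.
assert (L := cf_u2_lip CF x (Y x s) c (Y c s) ltac:(lra) ltac:(lra)).
assert (L' : M * (Rabs (x - c) + Rabs (Y x s - Y c s)) <= M * (3 * r)).
{ apply Rmult_le_compat_l; [assumption|].
  assert (Rabs (x - c) <= r) by (apply Rabs_le; lra).
  assert (Rabs (Y x s - Y c s) <= 2 * (r * r)) by (apply Rabs_le; lra).
  nra. }
assert (E' : u2 c (Y c s) * r = u1 c (Y c s) * (Y x s - Y (x - r) s)).
{ rewrite E; field; lra. }
assert (K : Rabs (u2 c (Y c s)) * r <= M * (2 * r) * r).
{ rewrite <- (Rabs_pos_eq r) at 1 by lra; rewrite <- Rabs_mult, E', Rabs_mult.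
  rewrite (Rabs_pos_eq (u1 c (Y c s))), Rmult_assoc by lra.
  apply Rmult_le_compat; [lra | apply Rabs_pos | assumption | apply Rabs_le; lra]. }
apply Rmult_le_reg_r in K; [|assumption].
replace (u2 x (Y x s)) with (u2 c (Y c s) + (u2 x (Y x s) - u2 c (Y c s))) by ring.
eapply Rle_lt_trans; [apply Rabs_triang|]; nra.
Qed.

(** * Derivatives along streamlines and Bernoulli's law *)

Lemma continuity_2d_pt_along (f : R -> R -> R) (x s : R) : 0 < s < Q ->
  continuity_2d_pt f x (Y x s) -> continuity_2d_pt (fun x s => f x (Y x s)) x s.
Proof.
intros Hs Hf eps; destruct (Hf eps) as [d1 D1].
destruct (Y_cont x s Hs d1) as [d2 D2].
assert (Hd : 0 < Rmin d1 d2) by (apply Rmin_glb_lt; apply cond_pos).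
exists (mkposreal _ Hd); simpl; intros t z Ht Hz.
pose proof (Rmin_l d1 d2); pose proof (Rmin_r d1 d2).
apply D1; [lra | apply D2; lra].
Qed.

Let along (f : R -> R -> R) x s := f x (Y x s).

Lemma is_derive_along_1 (f fx fy : R -> R -> R) (x s : R) : 0 < s < Q ->
  (forall x y, h0 x < y < h1 x -> differentiable_pt_lim f x y (fx x y) (fy x y)) ->
  is_derive (fun t => along f t s) x
    (along fx x s + along fy x s * (along u2 x s / along u1 x s)).
Proof.
intros Hs Hf; apply (differentiable_pt_lim_comp_curve f (fun t => Y t s)).
- now apply Hf, Y_spec.
- now apply is_derive_Y_1.
Qed.

Lemma is_derive_along_2 (f fx fy : R -> R -> R) (x s : R) : 0 < s < Q ->
  (forall x y, h0 x < y < h1 x -> differentiable_pt_lim f x y (fx x y) (fy x y)) ->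
  is_derive (fun t => along f x t) s (along fy x s / along u1 x s).
Proof.
intros Hs Hf.
replace (along fy x s / along u1 x s) with (scal (/ u1 x (Y x s)) (fy x (Y x s)))
  by (unfold along, scal, mult; simpl; unfold mult; simpl; unfold Rdiv; ring).
apply (is_derive_comp (V := R_NormedModule) (f x) (fun t => Y x t)).
- apply (differentiable_pt_lim_2 _ _ _ (fx x (Y x s))); now apply Hf, Y_spec.
- now apply is_derive_Y_2.
Qed.

Let Bern x s := along p x s + (along u1 x s ^ 2 + along u2 x s ^ 2) / 2.

(** The derivative along the streamline is the first momentum equation plus [u2 / u1] times the
    second, hence zero. *)
Lemma Bernoulli (x s : R) : 0 < s < Q -> Bern x s = Bern 0 s.
Proof.
intros Hs; apply Rminus_diag_uniq.
enough (A : Rabs (Bern x s - Bern 0 s) <= 0 * Rabs (x - 0)).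
{ rewrite Rmult_0_l in A.
  destruct (Req_dec (Bern x s - Bern 0 s) 0) as [E|E]; [exact E|].
  apply Rabs_pos_lt in E; lra. }
pose (D := fun (fx fy : R -> R -> R) t => along fx t s + along fy t s * (along u2 t s / along u1 t s)).
apply (increment_abs_le (fun t => Bern t s) (fun t => D px py t +
  (INR 2 * D u1x u1y t * along u1 t s ^ 1 + INR 2 * D u2x u2y t * along u2 t s ^ 1) * / 2)).
- intros t _; apply (is_derive_plus (V := R_NormedModule) (fun t => along p t s)).
  + apply is_derive_along_1; [assumption | apply (cf_p_diff CF)].
  + apply (is_derive_ext (fun t => / 2 * (along u1 t s ^ 2 + along u2 t s ^ 2)));
      [intros; apply Rmult_comm|].
    rewrite Rmult_comm; apply is_derive_scal, (is_derive_plus (V := R_NormedModule)).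
    * apply (is_derive_pow (fun t => along u1 t s) 2), is_derive_along_1;
        [assumption | apply (cf_u1_diff CF)].
    * apply (is_derive_pow (fun t => along u2 t s) 2), is_derive_along_1;
        [assumption | apply (cf_u2_diff CF)].
- intros t _; right; rewrite <- Rabs_R0; f_equal.
  destruct (Y_spec t s Hs) as [A _]; unfold D, along; simpl.
  pose proof (cf_pos CF _ _ A).
  pose proof (cf_momentum1 CF _ _ A) as E1; pose proof (cf_momentum2 CF _ _ A) as E2.
  set (y := Y t s) in *.
  replace (px t y) with (- (u1 t y * u1x t y + u2 t y * u1y t y)) by lra.
  replace (py t y) with (- (u1 t y * u2x t y + u2 t y * u2y t y)) by lra.
  field; lra.
Qed.

(** The bound [K] is left free above [M], so that two flows with different bounds can be compared
    under a common one. The first clause carries equality on streamlines back to points of the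
    channel. *)
Lemma channel_hodograph : exists Y : R -> R -> R,
  (forall x y, h0 x < y < h1 x -> exists s, 0 < s < Q /\ Y x s = y) /\
  forall K, M <= K -> exists P G B,
    hodograph h0 h1 Q K (fun s => poiseuille_speed Q s ^ 2) Y
      (fun x s => u1 x (Y x s)) (fun x s => u2 x (Y x s)) P G B.
Proof.
exists Y; split.
{ intros x y Hy; exists (psi x y); now apply Y_unique. }
intros K HK.
exists (along p), (fun x s => along py x s / along u1 x s), (fun s => Bern 0 s).
assert (ins : forall x s, 0 < s < Q -> h0 x < Y x s < h1 x /\ 0 < u1 x (Y x s)).
{ intros x s Hs; destruct (Y_spec x s Hs) as [A _]; split; [exact A|].
  now apply (cf_pos CF). }
split; intros.
- destruct (ins x s); trivial; lra.
- destruct (ins x s) as [A1 A2]; trivial; split; [assumption|].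
  apply Rle_trans with (2 := HK); eapply Rle_trans; [apply Rle_abs|].
  apply (cf_u1_bound CF); lra.
- destruct (ins x s); trivial; apply Rle_trans with (2 := HK), (cf_u2_bound CF); lra.
- now apply is_derive_Y_1.
- now apply is_derive_Y_2.
(* The second momentum equation divided by [u1]: the derivative along the streamline is the
   convective derivative over [u1]. *)
- replace (- (along py x s / along u1 x s)) with
    (along u2x x s + along u2y x s * (along u2 x s / along u1 x s)).
  + apply is_derive_along_1; [assumption | apply (cf_u2_diff CF)].
  + destruct (ins x s) as [A A2]; trivial.
    pose proof (cf_momentum2 CF _ _ A) as E; unfold along.
    replace (py x (Y x s)) with (- (u1 x (Y x s) * u2x x (Y x s) + u2 x (Y x s) * u2y x (Y x s)))
      by lra.
    field; lra.
- apply (is_derive_along_2 p px py); [assumption | apply (cf_p_diff CF)].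
- now apply Bernoulli.
- now apply Y_cont.
- destruct (ins x s); trivial; now apply continuity_2d_pt_along, u1_cont.
- destruct (ins x s); trivial; now apply continuity_2d_pt_along, u2_cont.
- destruct (ins x s); trivial; apply continuity_2d_pt_mult.
  + now apply continuity_2d_pt_along, (cf_py_cont CF).
  + apply continuity_2d_pt_inv; [|unfold along; lra].
    now apply continuity_2d_pt_along, u1_cont.
- now apply Y_near_walls.
- assert (sq : forall f l, is_lim f m_infty (Finite l) ->
    is_lim (fun x => f x ^ 2) m_infty (l ^ 2)).
  { intros f l Hf; apply is_lim_ext with (fun x => f x * f x); [intros; ring|].
    replace (l ^ 2) with (l * l) by ring.
    now apply (is_lim_mult f f m_infty l l). }
  replace (poiseuille_speed Q s ^ 2) with (poiseuille_speed Q s ^ 2 + 0 ^ 2) by ring.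
  apply is_lim_plus'; apply sq; [now apply u1_upstream | now apply u2_upstream].
Qed.

End Channel.

(** * Uniqueness *)

Lemma norm_pair_le (x y : R * R) :
  norm (minus x y) <= Rabs (fst x - fst y) + Rabs (snd x - snd y).
Proof.
set (r := Rabs (fst x - fst y)); set (s := Rabs (snd x - snd y)).
change (sqrt (r ^ 2 + s ^ 2) <= r + s).
assert (0 <= r) by apply Rabs_pos; assert (0 <= s) by apply Rabs_pos.
rewrite <- (sqrt_pow2 (r + s)) by lra; apply sqrt_le_1_alt; nra.
Qed.

Lemma continuous_curry (f : R * R -> R) (x y : R) :
  continuous f (x, y) -> continuity_2d_pt (fun x y => f (x, y)) x y.
Proof.
intros Hf; apply continuity_2d_pt_filterlim.
apply filterlim_ext with f; [now intros [] | exact Hf].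
Qed.

Lemma Ck_continuous (k : nat) (D : R * R -> Prop) (f : R * R -> R) (x : R * R) :
  Ck k D f -> D x -> continuous f x.
Proof. destruct k; intros [Hf _]; apply Hf. Qed.

Lemma Ck_differentiable (k : nat) (D : R * R -> Prop) (f : R * R -> R) (x y : R) :
  locally_2d (fun x y => D (x, y)) x y -> Ck (S k) D f ->
  differentiable_pt_lim (fun x y => f (x, y)) x y (Defs.d1 f (x, y)) (Defs.d2 f (x, y)).
Proof.
intros HD [_ [Hex [H1 _]]].
apply (differentiable_pt_lim_of_partials (fun x y => f (x, y)) (fun x y => Defs.d1 f (x, y))).
- destruct HD as [d Hd]; exists d; intros t z Ht Hz.
  apply (Derive_correct (fun t => f (t, z))), (Hex (t, z)), Hd; assumption.
- apply (Derive_correct (fun t => f (x, t))), (Hex (x, y)).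
  exact (locally_2d_singleton _ _ _ HD).
- apply continuous_curry, (Ck_continuous k D); [exact H1|].
  exact (locally_2d_singleton _ _ _ HD).
Qed.

Lemma nozzle_channel_flow (h0 h1 : R -> R) (alpha Lm Lp a b Q : R) (u : R * R -> R * R) :
  is_nozzle h0 h1 alpha Lm Lp a b -> is_nozzle_flow h0 h1 Q u ->
  exists H M p,
    channel_flow h0 h1 (Derive h0) (Derive h1) H M Q Lm
      (fun x y => comp1 u (x, y)) (fun x y => comp2 u (x, y)) (fun x y => p (x, y))
      (fun x y => Defs.d1 (comp1 u) (x, y)) (fun x y => Defs.d2 (comp1 u) (x, y))
      (fun x y => Defs.d1 (comp2 u) (x, y)) (fun x y => Defs.d2 (comp2 u) (x, y))
      (fun x y => Defs.d1 p (x, y)) (fun x y => Defs.d2 p (x, y)).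
Proof.
intros [_ [D0 [M0 [B0 _]]] [D1 [M1 [B1 _]]] lt01 _ _ inlet _]
  [[C1 C2] [M [bound lip]] [[p [Cp mom]] div] slip pos up].
assert (c0 : forall t, continuous h0 t).
{ intros t; apply (ex_derive_continuous (V := R_NormedModule)), D0. }
assert (c1 : forall t, continuous h1 t).
{ intros t; apply (ex_derive_continuous (V := R_NormedModule)), D1. }
assert (op : forall x y, h0 x < y < h1 x -> locally_2d (fun x y => Omega h0 h1 (x, y)) x y).
{ intros x y Hy; exact (graph_domain_open h0 h1 x y (c0 x) (c1 x) Hy). }
assert (cl : forall x y, h0 x <= y <= h1 x -> closure (Omega h0 h1) (x, y)).
{ intros x y Hy; now apply Omega_closure. }
assert (HM : 0 <= M).
{ apply Rle_trans with (norm (u (0, h0 0))); [apply norm_ge_0|].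
  apply bound, cl; pose proof (lt01 0); lra. }
assert (lip' : forall x y x' y', h0 x <= y <= h1 x -> h0 x' <= y' <= h1 x' ->
  norm (minus (u (x, y)) (u (x', y'))) <= M * (Rabs (x - x') + Rabs (y - y'))).
{ intros x y x' y' Hy Hy'; eapply Rle_trans; [apply lip; now apply cl|].
  apply Rmult_le_compat_l; [assumption | apply norm_pair_le]. }
assert (nrm : forall x, 0 < sqrt (1 + x ^ 2)).
{ intros x; apply sqrt_lt_R0; pose proof (pow2_ge_0 x); lra. }
exists (M0 + M1), M, p; split.
- intros x; apply Derive_correct, D0.
- intros x; apply Derive_correct, D1.
- exact lt01.
- intros x; destruct (B0 x) as [A0 _]; destruct (B1 x) as [A1 _].
  apply Rabs_le_between in A0; apply Rabs_le_between in A1; lra.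
- intros x; destruct (B0 x) as [_ [A0 _]]; destruct (B1 x) as [_ [A1 _]].
  pose proof (Rabs_pos (Derive h0 x)); pose proof (Rabs_pos (Derive h1 x)).
  repeat split; try lra.
  eapply Rle_trans; [apply Rabs_triang|]; rewrite Rabs_Ropp; lra.
- exact inlet.
- intros x y Hy; eapply Rle_trans; [|now apply bound, cl].
  apply (norm_le_prod_norm_1 (K := R_AbsRing) (u (x, y))).
- intros x y Hy; eapply Rle_trans; [|now apply bound, cl].
  apply (norm_le_prod_norm_2 (K := R_AbsRing) (u (x, y))).
- intros x y x' y' Hy Hy'; eapply Rle_trans; [|now apply lip'].
  apply (norm_le_prod_norm_1 (K := R_AbsRing) (minus (u (x, y)) (u (x', y')))).
- intros x y x' y' Hy Hy'; eapply Rle_trans; [|now apply lip'].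
  apply (norm_le_prod_norm_2 (K := R_AbsRing) (minus (u (x, y)) (u (x', y')))).
- intros x; assert (A := slip (x, h0 x)).
  rewrite Omega_boundary in A by assumption; specialize (A (or_introl eq_refl)).
  unfold dot, unit_normal in A; cbn [fst snd] in A.
  (* [unit_normal] tests for the upper wall; [lt01] selects the other branch on the lower one. *)
  pose proof (lt01 x); destruct (Req_EM_T (h0 x) (h1 x)) as [E|_]; [lra|]; cbn [fst snd] in A.
  unfold comp1, comp2; pose proof (nrm (Derive h0 x)).
  apply (Rmult_eq_reg_r (/ sqrt (1 + Derive h0 x ^ 2)));
    [unfold Rdiv in A; lra | apply Rinv_neq_0_compat; lra].
- intros x; assert (A := slip (x, h1 x)).
  rewrite Omega_boundary in A by assumption; specialize (A (or_intror eq_refl)).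
  unfold dot, unit_normal in A; cbn [fst snd] in A.
  destruct (Req_EM_T (h1 x) (h1 x)) as [_|E]; [|now elim E]; cbn [fst snd] in A.
  unfold comp1, comp2; pose proof (nrm (Derive h1 x)).
  apply (Rmult_eq_reg_r (/ sqrt (1 + Derive h1 x ^ 2)));
    [unfold Rdiv in A; lra | apply Rinv_neq_0_compat; lra].
- intros x y Hy; now apply (pos (x, y)).
- intros x y Hy; apply (Ck_differentiable 1 (Omega h0 h1)); [now apply op | assumption].
- intros x y Hy; apply (Ck_differentiable 1 (Omega h0 h1)); [now apply op | assumption].
- intros x y Hy; apply (Ck_differentiable 0 (Omega h0 h1)); [now apply op | assumption].
- intros x y Hy; destruct C1 as [_ [_ [C11 _]]].
  now apply continuous_curry, (Ck_continuous 1 (Omega h0 h1)).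
- intros x y Hy; destruct C2 as [_ [_ [_ C22]]].
  now apply continuous_curry, (Ck_continuous 1 (Omega h0 h1)).
- intros x y Hy; destruct Cp as [_ [_ [_ Cp2]]].
  now apply continuous_curry, (Ck_continuous 0 (Omega h0 h1)).
- intros x y Hy; now apply (div (x, y)).
- intros x y Hy; now apply (mom (x, y)).
- intros x y Hy; now apply (mom (x, y)).
- intros eps He; destruct (up (mkposreal eps He)) as [N HN]; exists N.
  intros x y Hx Hy; now apply HN.
Qed.

(** Moving [y] by a fraction [th] towards the midpoint brings it inside, where [f] and [g] agree, at
    a cost linear in [th]. This carries uniqueness from the open channel to its closure. *)
Lemma eq_of_lipschitz_inside (f g : R -> R) (lo hi K L y : R) : lo < hi ->
  (forall r s, lo <= r <= hi -> lo <= s <= hi -> Rabs (f r - f s) <= K * Rabs (r - s)) ->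
  (forall r s, lo <= r <= hi -> lo <= s <= hi -> Rabs (g r - g s) <= L * Rabs (r - s)) ->
  (forall r, lo < r < hi -> f r = g r) -> lo <= y <= hi -> f y = g y.
Proof.
intros Hlt Hf Hg E Hy.
assert (pos : forall (h : R -> R) k, (forall r s, lo <= r <= hi -> lo <= s <= hi ->
  Rabs (h r - h s) <= k * Rabs (r - s)) -> 0 <= k).
{ intros h k Hh; assert (A := Hh hi lo ltac:(lra) ltac:(lra)).
  rewrite (Rabs_pos_eq (hi - lo)) in A by lra; pose proof (Rabs_pos (h hi - h lo)); nra. }
assert (HK := pos _ _ Hf); assert (HL := pos _ _ Hg).
apply Rminus_diag_uniq; destruct (Req_dec (f y - g y) 0) as [Z|Z]; [exact Z|].
apply Rabs_pos_lt in Z.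
enough (Rabs (f y - g y) <= 0) by lra.
apply le_of_le_add_small with ((K + L) * (hi - lo)); [|apply Rmult_le_pos; lra].
intros th Ht.
set (z := y + th * ((lo + hi) / 2 - y)).
assert (Hz : lo < z < hi) by (unfold z; split; nra).
assert (D : Rabs (y - z) <= th * (hi - lo)) by (apply Rabs_le; unfold z; split; nra).
replace (f y - g y) with ((f y - f z) - (g y - g z)) by (rewrite (E z Hz); ring).
eapply Rle_trans; [apply Rabs_triang|]; rewrite Rabs_Ropp.
assert (A1 := Hf y z Hy ltac:(lra)); assert (A2 := Hg y z Hy ltac:(lra)).
assert (K * Rabs (y - z) <= K * (th * (hi - lo))) by (apply Rmult_le_compat_l; lra).
assert (L * Rabs (y - z) <= L * (th * (hi - lo))) by (apply Rmult_le_compat_l; lra).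
lra.
Qed.

Theorem theorem1p2 (h0 h1 : R -> R) (alpha Lm Lp a b Q : R)
  (Hnozzle : is_nozzle h0 h1 alpha Lm Lp a b) (HQ : 0 < Q)
  (u v : R * R -> R * R)
  (Hu : is_nozzle_flow h0 h1 Q u) (Hv : is_nozzle_flow h0 h1 Q v) :
  forall x : R * R, closure (Omega h0 h1) x -> u x = v x.
Proof.
destruct (nozzle_channel_flow _ _ _ _ _ _ _ _ _ Hnozzle Hu) as [H [M [p CU]]].
destruct (nozzle_channel_flow _ _ _ _ _ _ _ _ _ Hnozzle Hv) as [H' [M' [p' CV]]].
destruct (channel_hodograph _ _ _ _ _ _ _ _ _ _ _ _ _ _ _ _ _ CU) as [Y [onto HY]].
destruct (channel_hodograph _ _ _ _ _ _ _ _ _ _ _ _ _ _ _ _ _ CV) as [Z [_ HZ]].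
destruct (HY (Rmax M M') (Rmax_l _ _)) as [P [G [B hodU]]].
destruct (HZ (Rmax M M') (Rmax_r _ _)) as [P' [G' [B' hodV]]].
assert (inside : forall x, Omega h0 h1 x -> u x = v x).
(* The point lies on a streamline of [u]; by equality of heights the streamline of [v] with the same
   flux passes through it too, so agreement along streamlines becomes agreement at the point. *)
{ intros [x y] Hx; destruct (onto x y Hx) as [s [Hs E]].
  assert (EY := heights_agree _ _ _ _ _ _ _ _ _ _ _ _ _ _ _ _ _ _ (cf_height CU) hodU hodV x s Hs).
  destruct (velocities_agree _ _ _ _ _ _ _ _ _ _ _ _ _ _ _ _ _ _ (cf_height CU) hodU hodV x s Hs)
    as [E1 E2].
  rewrite <- EY, E in E1, E2; now apply injective_projections. }
intros [x y] Hx.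
apply Omega_closure in Hx; simpl in Hx.
2: exact (fun t => is_derive_continuous _ _ _ (cf_h0 CU t)).
2: exact (fun t => is_derive_continuous _ _ _ (cf_h1 CU t)).
2: exact (cf_lt CU).
pose proof (cf_lt CU x).
apply injective_projections.
- apply (eq_of_lipschitz_inside (fun y => comp1 u (x, y)) (fun y => comp1 v (x, y))
    (h0 x) (h1 x) M M'); trivial.
  + intros r s Hr Hs; eapply Rle_trans; [now apply (cf_u1_lip CU)|].
    rewrite Rminus_diag, Rabs_R0; right; ring.
  + intros r s Hr Hs; eapply Rle_trans; [now apply (cf_u1_lip CV)|].
    rewrite Rminus_diag, Rabs_R0; right; ring.
  + intros r Hr; unfold comp1; now rewrite inside.
- apply (eq_of_lipschitz_inside (fun y => comp2 u (x, y)) (fun y => comp2 v (x, y))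
    (h0 x) (h1 x) M M'); trivial.
  + intros r s Hr Hs; eapply Rle_trans; [now apply (cf_u2_lip CU)|].
    rewrite Rminus_diag, Rabs_R0; right; ring.
  + intros r s Hr Hs; eapply Rle_trans; [now apply (cf_u2_lip CV)|].
    rewrite Rminus_diag, Rabs_R0; right; ring.
  + intros r Hr; unfold comp2; now rewrite inside.
Qed.
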